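(* Let $k\in\mathbb{Z}$, $\nu>0$, $B\in\mathbb{R}$. For any positive continuous functions $a_1,a_2:[1,\infty)\to(0,\infty)$ and any strictly decreasing function $\phi:[1,\infty)\to\mathbb{R}$, there exists a sequence $\{(w_n,f_n)\}_{n\in\mathbb{N}}$ of functions on $(0,\infty)\times(1,\infty)$ such that for every $n$ $$\partial_t w_n+\mathcal{T}w_n=f_n,\qquad w_n|_{t=0}=0,\qquad w_n|_{r=1,\infty}=0,$$ and $$\|e^{t\phi(r)}a_1(r)w_n\|_{L^2((0,\infty);L^2_r)}+\|e^{t\phi(r)}a_2(r)f_n\|_{L^2((0,\infty);L^2_r)}<+\infty,$$ but $$\limsup_{n\to+\infty}\frac{\|e^{t\phi(r)}a_1(r)w_n\|_{L^2((0,\infty);L^2_r)}}{\|e^{t\phi(r)}a_2(r)f_n\|_{L^2((0,\infty);L^2_r)}}=+\infty.$$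
   Context: $L^2_r:=L^2((1,\infty),dr)$ (complex-valued functions). For $k\in\mathbb{Z}$, $\nu>0$, $B\in\mathbb{R}$, $$\mathcal{T}:=-\nu\Bigl(\partial_r^2-\frac{k^2-1/4}{r^2}\Bigr)+\frac{ikB}{r^2},$$ acting on $L^2_r$ with domain $D:=H^2((1,\infty),dr)\cap H^1_0((1,\infty),dr)$. The equation is understood in the strong sense: $f_n\in L^2_{loc}([0,\infty);L^2_r)$, $w_n\in C([0,\infty);L^2_r)\cap L^2_{loc}([0,\infty);D)$, $\partial_t w_n\in L^2_{loc}([0,\infty);L^2_r)$, and the equation holds almost everywhere. *)

(* Defs.v *)
From HB Require Import structures.
From mathcomp Require Import all_boot all_order all_algebra.
From mathcomp Require Import all_classical all_reals all_analysis.
From mathcomp Require Export complex.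

Set Implicit Arguments.
Unset Strict Implicit.
Unset Printing Implicit Defensive.

Import Order.TTheory GRing.Theory Num.Theory.
Import numFieldNormedType.Exports.

Local Open Scope classical_set_scope.
Local Open Scope complex_scope.
Local Open Scope ring_scope.

Section defs.
Context {R : realType}.
Local Notation leb := (@lebesgue_measure R).
Implicit Types (u v : R -> R[i]) (w f : R -> R -> R[i]).

Definition cmeasurable d (T : measurableType d) (A : set T) (u : T -> R[i]) :=
  measurable_fun A (fun x => complex.Re (u x)) /\
  measurable_fun A (fun x => complex.Im (u x)).

Definition cintegral (A : set R) u : R[i] :=
  (\int[leb]_(x in A) complex.Re (u x)) +i*
  (\int[leb]_(x in A) complex.Im (u x)).

Definition Omega : set R := `]1, +oo[.
Definition Time : set R := `]0, +oo[.

Definition L2r_norm u : \bar R :=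
  Lnorm leb 2%:E ((fun r => (ComplexField.Normc.normc (u r))%:E) \_ Omega)%E.

Definition L2r u := cmeasurable Omega u /\ (L2r_norm u < +oo)%E.

(* Real-valued elements of C_c^oo(I), extended by zero to the whole line. *)
Definition test_fun (I : set R) (th : R -> R) :=
  (forall n x, derivable (derive1n n th) x 1) /\
  exists K : set R, [/\ compact K, K `<=` I & forall x, ~ K x -> th x = 0].

(* [v] is the weak derivative of [u] on (1, oo); by linearity real-valued test
   functions suffice. *)
Definition weak_deriv u v :=
  forall th, test_fun Omega th ->
    cintegral Omega (fun r => u r * (derive1 th r)%:C) =
    - cintegral Omega (fun r => v r * (th r)%:C).

Definition H2r u :=
  L2r u /\ exists u1 u2, [/\ L2r u1, L2r u2, weak_deriv u u1 & weak_deriv u1 u2].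

(* H^1_0(1, oo), the H^1-closure of the complex-valued test functions
   [p m + i q m]. *)
Definition H10r u :=
  L2r u /\ exists u1, [/\ L2r u1, weak_deriv u u1 &
    exists p q : nat -> R -> R,
    [/\ forall m, test_fun Omega (p m) /\ test_fun Omega (q m),
        L2r_norm (fun r => p m r +i* q m r - u r) @[m --> \oo] --> 0%E &
        L2r_norm (fun r => derive1 (p m) r +i* derive1 (q m) r - u1 r)
          @[m --> \oo] --> 0%E]].

Definition domT u := H2r u /\ H10r u.

(* [u2] stands for the second (weak) derivative of [u]. *)
Definition opT (k : int) (nu B : R) u (u2 : R -> R[i]) : R -> R[i] := fun r =>
  - nu%:C * (u2 r - ((k%:~R ^+ 2 - 4^-1) / r ^+ 2)%:C * u r)
  + 'i%C * (k%:~R * B / r ^+ 2)%:C * u r.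

Definition L2t_norm (I : set R) w : \bar R :=
  Lnorm leb 2%:E ((fun t => L2r_norm (w t)) \_ I)%E.

(* An element of L^2_loc([0, oo); L^2_r) is given by a jointly measurable
   representative on (0, oo) x (1, oo). *)
Definition L2loc w :=
  cmeasurable (Time `*` Omega) (fun z : R * R => w z.1 z.2) /\
  forall T : R, 0 < T -> (L2t_norm `]0%R, T[ w < +oo)%E.

Definition contL2 w :=
  (forall t, 0 <= t -> L2r (w t)) /\
  forall t0, 0 <= t0 ->
    L2r_norm (fun r => w t r - w t0 r)
      @[t --> within `[0, +oo[ (nbhs t0)] --> 0%E.

(* w in L^2_loc([0, oo); domT), for the H^2 norm, with spatial derivatives
   [w1] and [w2]. *)
Definition L2loc_domT w (w1 w2 : R -> R -> R[i]) :=
  [/\ L2loc w, L2loc w1, L2loc w2 &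
    {ae leb, forall t, Time t ->
      [/\ domT (w t), weak_deriv (w t) (w1 t) & weak_deriv (w1 t) (w2 t)]}].

(* [wt] is the distributional time derivative of the L^2_r-valued function [w]
   on (0, oo): the L^2_r-valued integrals are computed pointwise in [r], and
   their equality in L^2_r is equality for almost every [r]. *)
Definition time_weak_deriv w (wt : R -> R -> R[i]) :=
  forall th, test_fun Time th ->
    {ae leb, forall r, Omega r ->
      cintegral Time (fun t => w t r * (derive1 th t)%:C) =
      - cintegral Time (fun t => wt t r * (th t)%:C)}.

(* Strong solutions of [d_t w + T w = f], [w|_{t=0} = 0], [w|_{r=1,oo} = 0].
   The boundary condition is the membership of [w t] in H^1_0. *)
Definition strong_solution (k : int) (nu B : R) w f :=
  [/\ L2loc f, contL2 w, {ae leb, forall r, Omega r -> w 0 r = 0} &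
    exists w1 w2 wt : R -> R -> R[i],
    [/\ L2loc_domT w w1 w2, L2loc wt, time_weak_deriv w wt &
      {ae leb, forall t, Time t -> {ae leb, forall r, Omega r ->
         wt t r + opT k nu B (w t) (w2 t) r = f t r}}]].

Definition weighted_norm (phi a : R -> R) w : \bar R :=
  L2t_norm Time (fun t r => (expR (t * phi r) * a r)%:C * w t r).

End defs.

(* Main.v *)
Require Import Defs.
From HB Require Import structures.
From mathcomp Require Import all_boot all_order all_algebra.
From mathcomp Require Import all_classical all_reals all_analysis.
From mathcomp Require Import measurable_realfun complex ring lra.
Import Order.TTheory GRing.Theory Num.Theory.
Import numFieldNormedType.Exports.
Local Open Scope classical_set_scope.
Local Open Scope ring_scope.

Set Implicit Arguments.
Unset Strict Implicit.
Unset Printing Implicit Defensive.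

(** Put [lam = sup_{r > 1} phi r] and [x = r - 1], and take [w = X(t) g(r)] with
    [g] compactly supported, [g = x + b x^3 + O(x^4)], where [b] is chosen so
    that [(T - lam) g = O(x^2)].  For [X(t) = chi(t) e^(-lam t)] the source is
    [f = e^(-lam t) (chi' g + chi (T - lam) g)], and the weight
    [e^(t (phi - lam))] is at most [1] and decays exponentially in [t] away
    from [r = 1], so that for large [t] only small [x] matters, where
    [(T - lam) g] is negligible against [g].  With [y = e^(mu t)] and
    [chi = (y - 1) / (1 + eps y^2)] one has [chi' = O(mu chi)] once [y >= 2],
    whence [||f||^2 <= kap ||w||^2 + K] where [kap] is as small as desired (by
    the choice of [mu]) and [K] does not depend on [eps].  Since the mass of the
    weight near [r = 1] decays subexponentially in [t], [||w||] tends to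
    infinity as [eps] tends to [0].

    Membership of [g] in H^1_0 is shown with the cutoffs
    [exp(-1 / (n x - 1))], extended by zero: they tend to [1] at every [x > 0],
    and their derivatives remain bounded after multiplication by [x]. *)

(** * Flat functions *)

Section flat_functions.
Context {R : realType}.
Implicit Types (P : {poly R}) (x y a b : R) (f g : R -> R).

(** The growing factor [y = e^(mu t)] cannot be omitted: for [phi r = 1 - r], where [lam = 0], the
    function [e^(2 t (phi - lam)) g^2] is already integrable in [t] and [r], because [g] vanishes at
    the boundary, so a bounded [chi] would leave [||w||] bounded. The growth has a price and a
    limit. Its derivative contributes a term of order [mu] to the ratio, and it must stay slower
    than the decay at rate [lam - phi (1 + x0)] of the weight on [x >= x0], so that this region
    contributes to [K] uniformly in [eps]. This dictates the order of the choices: [x0] from the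
    target ratio, [mu] from [x0] and the gap [lam - phi (1 + x0)], then [K], and [eps] last. For
    fixed [eps] the denominator [1 + eps y^2] turns the growth into decay like [1 / y], which makes
    the norms finite; the numerator [y - 1] encodes the initial condition. The equation for [b] is
    linear and solvable for every real [lam]; its solution is complex because of the term
    [i k B / r^2], so the space profile is a pair of real polynomials, truncated at [r = 2]. *)

Definition flat P x : R := if 0 < x then P.[x^-1] * expR (- x^-1) else 0.

Lemma expR_monomial_bound n y : 0 <= y -> y ^+ n * expR (- y) <= n`!%:R.
Proof.
move=> y0; rewrite expRN ler_pdivrMr ?expR_gt0//.
case: n => [|n].
  by rewrite expr0 fact0 mul1r (le_trans _ (expR_ge1Dx y))// lerDl.
rewrite -ler_pdivrMl ?ltr0n ?fact_gt0// mulrC.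
by rewrite (le_trans _ (expR_ge1Dxn n y0))// lerDr.
Qed.

Lemma horner_expR_bound P : exists2 C : R, 0 <= C &
  forall y, 0 <= y -> `|P.[y] * expR (- y)| <= C.
Proof.
exists (\sum_(i < size P) `|P`_i| * i`!%:R).
  by apply: sumr_ge0 => i _; rewrite mulr_ge0.
move=> y y0; rewrite horner_coef mulr_suml (le_trans (ler_norm_sum _ _ _))//.
apply: ler_sum => i _; rewrite -mulrA normrM ler_wpM2l//.
by rewrite ger0_norm ?expR_monomial_bound// mulr_ge0 ?exprn_ge0 ?expR_ge0.
Qed.

Lemma flat_bounded P : exists2 C : R, 0 <= C & forall x, `|flat P x| <= C.
Proof.
have [C C0 HC] := horner_expR_bound P.
exists C => // x; rewrite /flat; case: ifPn => [x0|_]; last by rewrite normr0.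
by rewrite HC// invr_ge0 ltW.
Qed.

Lemma flatXM P x : flat ('X * P) x = x^-1 * flat P x.
Proof.
rewrite /flat; case: ifP => x0; last by rewrite mulr0.
by rewrite hornerM hornerX mulrA.
Qed.

Lemma flatD P Q x : flat (P + Q) x = flat P x + flat Q x.
Proof.
by rewrite /flat; case: ifP => x0; rewrite ?addr0// hornerD mulrDl.
Qed.

Lemma flat_le0 P x : x <= 0 -> flat P x = 0.
Proof. by rewrite /flat ltNge => ->. Qed.

(** Both functions vanish at [a], so the difference quotients of [f] are dominated by those of [g].
    This handles the gluing points of piecewise definitions: [0] for [flat] and [2] for [cut]. *)
Lemma is_derive_dominated f g a : (forall x, `|f x| <= `|g x|) -> g a = 0 ->
  is_derive a 1 g 0 -> is_derive a 1 f 0.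
Proof.
move=> fg ga [dg Dg].
have fa : f a = 0 by apply/eqP; rewrite -normr_le0 (le_trans (fg a))// ga normr0.
have cg : h^-1 *: ((g \o shift a) (h *: (1:R)) - g a) @[h --> 0^'] --> 'D_1 g a.
  exact: dg.
rewrite Dg in cg.
have cf : h^-1 *: ((f \o shift a) (h *: (1:R)) - f a) @[h --> 0^'] --> (0:R).
  apply/cvgr0Pnorm_le => e e0; have /cvgr0Pnorm_le/(_ e e0) := cg.
  apply: filterS => h; apply: le_trans.
  by rewrite ga fa !subr0 !normrZ ler_wpM2l//; exact: fg.
apply: DeriveDef; first by apply/cvg_ex; exists 0.
by rewrite /derive; apply: cvg_lim.
Qed.

(** The polynomial factor makes the family closed under differentiation: with [y = x^-1] and
    [y' = - y^2], the derivative of [P(y) e^(-y)] is [y^2 (P - P')(y) e^(-y)]. *)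
Lemma is_derive_flat P x :
  is_derive x 1 (flat P) (flat ('X^2 * (P - P^`())) x).
Proof.
have [x0|x0|->] := ltgtP x 0.
- rewrite [X in is_derive _ _ _ X]flat_le0 ?ltW//.
  apply: (@near_eq_is_derive _ _ _ (cst (0:R))).
  near=> z; rewrite /= flat_le0// ltW//; near: z; exact: lt_nbhsl.
- apply: (@near_eq_is_derive _ _ _ (fun z : R => P.[z^-1] * expR (- z^-1))).
    near=> z; rewrite /flat ifT//; near: z; exact: lt_nbhsr.
  have xN0 : x != 0 by rewrite gt_eqF.
  have dV : is_derive x 1 (fun z : R => z^-1) (- x ^- 2).
    apply: trigger_derive; first exact: (@is_deriveV _ id).
    by rewrite /GRing.scale/= mulr1.
  have dP : is_derive x 1 (fun z : R => P.[z^-1]) (P^`().[x^-1] * (- x ^- 2)).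
    exact: (@is_derive1_comp _ (horner P) (fun z => z^-1)).
  have dE : is_derive x 1 (fun z : R => expR (- z^-1)) (expR (- x^-1) * x ^- 2).
    have dN : is_derive x 1 (fun z : R => - z^-1) (x ^- 2).
      by apply: (is_derive_eq (is_deriveN dV)); rewrite opprK.
    exact: (@is_derive1_comp _ expR (fun z => - z^-1)).
  apply: (is_derive_eq (is_deriveM dP dE)).
  rewrite /flat x0 hornerM hornerXn hornerD hornerN /GRing.scale/= -exprVn.
  by ring.
- rewrite [X in is_derive _ _ _ X]flat_le0//.
  (* [flat P z] is [z ^+ 2 * flat ('X^2 * P) z] for [z > 0], hence dominated by [C * z ^+ 2], whose
     derivative at [0] vanishes. *)
  have [C C0 HC] := flat_bounded ('X^2 * P).
  have dq : is_derive (0:R) 1 (horner (C *: 'X^2)) 0.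
    apply: is_derive_eq.
    by rewrite derivZ derivXn hornerZ hornerMn hornerXn expr1 mul0rn mulr0.
  apply: (@is_derive_dominated _ (horner (C *: 'X^2)) 0 _ _ dq) => [z|]; last by rewrite hornerZ hornerXn expr0n mulr0.
  have [z0|z0] := leP z 0; first by rewrite flat_le0// normr0.
  rewrite hornerZ hornerXn [leRHS]ger0_norm; last exact: mulr_ge0 (sqr_ge0 z).
  have := HC z; rewrite /flat z0 hornerM hornerXn -mulrA normrM exprVn.
  by rewrite ger0_norm ?invr_ge0 ?sqr_ge0// mulrC ler_pdivrMr ?exprn_gt0.
Unshelve. all: by end_near. Qed.

(** A class stable under differentiation, so that a single induction gives derivability at every
    order, as [test_fun] requires. *)
Inductive smooth_class : (R -> R) -> Prop :=
| smooth_horner P : smooth_class (horner P)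
| smooth_flat P a b : smooth_class (fun x => flat P (a * x + b))
| smooth_add f g : smooth_class f -> smooth_class g ->
    smooth_class (fun x => f x + g x)
| smooth_mul f g : smooth_class f -> smooth_class g ->
    smooth_class (fun x => f x * g x).

Lemma is_derive_affine a b x : is_derive x 1 (fun z : R => a * z + b) a.
Proof.
have -> : (fun z : R => a * z + b) = horner (a *: 'X + b%:P).
  by apply/funext => z; rewrite !hornerE.
apply: is_derive_eq.
by rewrite derivD derivZ derivX derivC addr0 !hornerE.
Qed.

Lemma is_derive_expRM a x :
  is_derive x 1 (fun z : R => expR (a * z)) (a * expR (a * x)).
Proof.
rewrite mulrC; apply: (@is_derive1_comp _ expR (fun z => a * z)).
have := is_derive_affine a 0 x.
by under eq_fun do rewrite addr0.
Qed.

Lemma is_derive_flat_affine P a b x : is_derive x 1 (fun z => flat P (a * z + b))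
  (a * flat ('X^2 * (P - P^`())) (a * x + b)).
Proof.
rewrite mulrC; apply: (@is_derive1_comp _ (flat P) (fun z => a * z + b)).
  exact: is_derive_flat.
exact: is_derive_affine.
Qed.

Lemma smooth_class_derive f : smooth_class f ->
  exists2 g, smooth_class g & forall x, is_derive x 1 f (g x).
Proof.
elim=> {f} [P|P a b|f g _ [f' sf' df] _ [g' sg' dg]|f g sf [f' sf' df] sg [g' sg' dg]].
- by exists (horner P^`()) => [|x]; [exact: smooth_horner|exact: is_derive_poly].
- exists (fun x => (a%:P).[x] * flat ('X^2 * (P - P^`())) (a * x + b)).
    by apply: smooth_mul; [exact: smooth_horner|exact: smooth_flat].
  by move=> x; rewrite hornerC; exact: is_derive_flat_affine.
- exists (fun x => f' x + g' x); first exact: smooth_add.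
  by move=> x; exact: (@is_deriveD _ _ _ f g).
- exists (fun x => f x * g' x + g x * f' x).
    by apply: smooth_add; exact: smooth_mul.
  by move=> x; exact: (@is_deriveM _ _ f g).
Qed.

Lemma smooth_class_derivable f : smooth_class f ->
  forall n x, derivable (derive1n n f) x 1.
Proof.
move=> sf n; elim: n f sf => [|n IHn] f sf x.
  by have [g _ /(_ x) []] := smooth_class_derive sf.
have [g sg dg] := smooth_class_derive sf.
rewrite derive1Sn; have -> : derive1 f = g; last exact: IHn.
by apply/funext => z; rewrite derive1E; have [_] := dg z.
Qed.

Lemma flat1_bounds y : 0 <= flat 1 y <= 1.
Proof.
rewrite /flat; case: ifP => y0; last by rewrite lexx ler01.
by rewrite hornerC mul1r expR_ge0 expR_le1 oppr_le0 invr_ge0 ltW.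
Qed.

Lemma flat1_tail y : 0 < y -> 1 - y^-1 <= flat 1 y.
Proof.
by move=> y0; rewrite /flat y0 hornerC mul1r expR_ge1Dx.
Qed.

Lemma cvg_mulrn_pinfty x : 0 < x -> (n%:R * x - 1) @[n --> \oo] --> +oo.
Proof.
move=> x0; apply/cvgryPge => A; near=> n.
rewrite lerBrDr -ler_pdivrMr//; near: n; exact: nbhs_infty_ger.
Unshelve. all: by end_near. Qed.

Lemma cvg_flat1 x : 0 < x -> flat 1 (n%:R * x - 1) @[n --> \oo] --> (1:R).
Proof.
move=> x0; have /cvgryPgt Hy := cvg_mulrn_pinfty x0.
apply: (@squeeze_cvgr _ _ _ _ (fun n => 1 - (n%:R * x - 1)^-1) (cst 1)).
- near=> n; rewrite (andP (flat1_bounds _)).2 andbT flat1_tail//.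
  by near: n; exact: Hy.
- rewrite -[X in _ --> X]subr0; apply: cvgB; first exact: cvg_cst.
  by apply/(@gtr0_cvgV0 _ _ _ _ (fun n : nat => n%:R * x - 1));
    [near=> n; near: n; exact: Hy|exact: cvg_mulrn_pinfty].
- exact: cvg_cst.
Unshelve. all: by end_near. Qed.

(* The factor [n] produced by differentiating [flat 1 (n x - 1)] is absorbed by
   [x], because the profiles vanish at least linearly at both end points. *)
Lemma flat_derive_scale n x : x * (n%:R * flat 'X^2 (n%:R * x - 1)) =
  flat ('X + 'X^2) (n%:R * x - 1).
Proof.
have [y0|y0] := leP (n%:R * x - 1) 0; first by rewrite !flat_le0// !mulr0.
rewrite flatD mulrA (mulrC x) -{1}(subrK 1 (n%:R * x)) mulrDl mul1r; congr (_ + _).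
by rewrite expr2 flatXM mulrA mulfV ?mul1r// gt_eqF.
Qed.

(** By [flat_derive_scale] this is [x^-1 * flat ('X * (1 + 'X))] at [y = n x - 1]; the factor ['X]
    comes out as [y^-1], which tends to [0], and the rest is bounded. *)
Lemma cvg_flat_derive x : 0 < x ->
  n%:R * flat 'X^2 (n%:R * x - 1) @[n --> \oo] --> (0:R).
Proof.
move=> x0.
have -> : (fun n : nat => n%:R * flat 'X^2 (n%:R * x - 1)) =
    (fun n : nat => x^-1 * flat ('X * (1 + 'X)) (n%:R * x - 1)).
  apply/funext => n; rewrite mulrDr mulr1 -expr2 -flat_derive_scale.
  by rewrite mulKf// gt_eqF.
have [C C0 HC] := flat_bounded (1 + 'X : {poly R}).
rewrite -(mulr0 x^-1); apply: cvgMr.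
have Hy := @cvg_mulrn_pinfty x x0.
apply/cvgrPdist_le => e e0; near=> n.
rewrite sub0r normrN flatXM normrM normfV mulrC.
have y0 : 0 < n%:R * x - 1 by near: n; move/cvgryPgt : Hy; exact.
rewrite ler_pdivrMr ?normr_gt0 ?gt_eqF// (le_trans (HC _))//.
rewrite gtr0_norm// mulrC -ler_pdivrMr//.
by near: n; move/cvgryPge : Hy; exact.
Unshelve. all: by end_near. Qed.

End flat_functions.

(** * Square-integral norms *)

Section L2_norms.
Context {R : realType}.
Local Notation leb := (@lebesgue_measure R).
Implicit Types (u : R -> R[i]) (W V : R -> R -> R[i]) (I : set R).

Definition sqnormc (z : R[i]) : R := complex.Re z ^+ 2 + complex.Im z ^+ 2.

Lemma sqnormc_ge0 z : 0 <= sqnormc z.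
Proof. by rewrite addr_ge0 ?sqr_ge0. Qed.

Lemma normc_sqr z : ComplexField.Normc.normc z ^+ 2 = sqnormc z.
Proof. by case: z => a b /=; rewrite sqr_sqrtr// addr_ge0 ?sqr_ge0. Qed.

Lemma sqnormcZ (a : R) (z : R[i]) : sqnormc (a%:C * z)%C = a ^+ 2 * sqnormc z.
Proof. by case: z => x y; rewrite /sqnormc/= !mul0r subr0 addr0 !exprMn mulrDr. Qed.

Lemma normc_ge0 (z : R[i]) : 0 <= ComplexField.Normc.normc z.
Proof. by case: z => a b /=; exact: sqrtr_ge0. Qed.

Lemma measurable_Omega : measurable (@Omega R).
Proof. exact: measurable_itv. Qed.

Lemma measurable_Time : measurable (@Time R).
Proof. exact: measurable_itv. Qed.

Lemma L2r_normE u :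
  L2r_norm u = sqrte (\int[leb]_(r in Omega) (sqnormc (u r))%:E)%E.
Proof.
rewrite -poweR12_sqrt; last first.
  by apply: integral_ge0 => r _; rewrite lee_fin sqnormc_ge0.
rewrite /L2r_norm unlock; congr (_ `^ _)%E.
rewrite [RHS]integral_mkcond; apply: eq_integral => r _.
rewrite !patchE; case: ifP => _; last by rewrite abse0 poweR0r.
rewrite gee0_abs ?lee_fin ?normc_ge0// poweR_EFin.
by rewrite powR_mulrn ?normc_ge0// normc_sqr.
Qed.

Lemma L2t_normE I W : L2t_norm I W =
  sqrte (\int[leb]_(t in I) \int[leb]_(r in Omega) (sqnormc (W t r))%:E)%E.
Proof.
have I0 t : (0 <= \int[leb]_(r in Omega) (sqnormc (W t r))%:E)%E.
  by apply: integral_ge0 => r _; rewrite lee_fin sqnormc_ge0.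
rewrite -poweR12_sqrt; last by apply: integral_ge0.
rewrite /L2t_norm unlock; congr (_ `^ _)%E.
rewrite [RHS]integral_mkcond; apply: eq_integral => t _.
rewrite !patchE; case: ifP => _; last by rewrite abse0 poweR0r.
by rewrite L2r_normE gee0_abs ?sqrte_ge0// -poweR12_sqrt// -poweRrM mulVf// poweRe1.
Qed.

Lemma measurable_sqnormc d (T : measurableType d) (A : set T) (w : T -> R[i]) :
  cmeasurable A w -> measurable_fun A (fun x => (sqnormc (w x))%:E).
Proof.
by move=> [mre mim]; apply/measurable_EFinP; apply: measurable_funD;
  exact: measurable_funX.
Qed.

Lemma measurable_sqnormc_section W t : Time t ->
  cmeasurable (Time `*` Omega) (fun z : R * R => W z.1 z.2) ->
  measurable_fun Omega (fun r => (sqnormc (W t r))%:E).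
Proof.
move=> tT /measurable_sqnormc /(measurable_restrictT _ _).1 mW.
have {}mW := mW (measurableX measurable_Time measurable_Omega).
apply/(measurable_restrictT _ measurable_Omega).
have := measurable_fun_pair2 t mW.
apply: eq_measurable_fun => r _; rewrite !patchE.
case: ifPn => [/set_mem [_ rO]|]; first by rewrite mem_set.
by case: ifPn => // /set_mem rO; rewrite mem_set.
Qed.

Lemma measurable_L2r_section I W : measurable I -> I `<=` Time ->
  cmeasurable (Time `*` Omega) (fun z : R * R => W z.1 z.2) ->
  measurable_fun I (fun t => \int[leb]_(r in Omega) (sqnormc (W t r))%:E)%E.
Proof.
move=> mI IT /measurable_sqnormc /(measurable_restrictT _ _).1 mW.
have {}mW := mW (measurableX measurable_Time measurable_Omega).
have := measurable_fun_fubini_tonelli_F (m2 := leb) _ mW.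
move=> /(_ _)/(measurable_funS measurableT (@subsetT _ I)) h.
apply: eq_measurable_fun (h _) => [t /set_mem tI|z].
  rewrite /fubini_F [RHS]integral_mkcond; apply: eq_integral => r _.
  rewrite !patchE.
  case: ifPn => [/set_mem [_ rO]|]; first by rewrite mem_set.
  case: ifPn => // /set_mem rO; rewrite mem_set//; split=> //; exact: IT.
by rewrite patchE; case: ifP => // _; rewrite lee_fin sqnormc_ge0.
Qed.

(** Since [(1, 2)] has length one, a bound of this shape costs exactly its constant. It records size
    and support at once and is the form of most upper bounds below. *)
Lemma integral_unit_cutoff (c : R) : 0 <= c ->
  (\int[leb]_(r in Omega) (if r < 2 then c else 0)%:E)%E = c%:E.
Proof.
move=> c0.
have -> : (\int[leb]_(r in Omega) (if r < 2 then c else 0)%:E)%E =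
          (\int[leb]_(r in Omega `&` `]-oo, 2%R[) cst c%:E r)%E.
  rewrite integral_mkcondr; apply: eq_integral => r _; rewrite patchE.
  by case: ifPn => r2; [rewrite mem_set//= in_itv/=|rewrite memNset//= in_itv/=; exact/negP].
rewrite integral_cst/=; last by apply: measurableI; exact: measurable_itv.
rewrite /Omega; have -> : `](1:R), +oo[%classic `&` `]-oo, 2%R[%classic = `]1%R, 2%R[%classic.
  apply/seteqP; split => r /=; rewrite !in_itv/= ?andbT; first by move=> [-> ->].
  by move/andP.
rewrite lebesgue_measure_itv/= lte_fin ltr1n -EFinD.
by rewrite [X in (_ * X%:E)%E](_ : _ = 1) ?mule1//; lra.
Qed.

Lemma measurable_unit_cutoff (A : set R) (c : R) : measurable A ->
  measurable_fun A (fun r => (if r < 2 then c else 0)%:E).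
Proof.
move=> mA; apply/measurable_EFinP; apply: (measurable_funS measurableT) => //.
apply: measurable_fun_ifT => //=.
by apply: measurable_fun_ltr.
Qed.

(** Used in two ways: with [W = 0] and [kap = 0] it bounds a single norm, and with [kap > 0] it
    compares the source with the solution, [H] being an error supported in [r < 2]. *)
Lemma sqint_le I W V (kap : R) (H : R -> R) : measurable I -> I `<=` Time ->
  cmeasurable (Time `*` Omega) (fun z : R * R => W z.1 z.2) ->
  cmeasurable (Time `*` Omega) (fun z : R * R => V z.1 z.2) ->
  measurable_fun I H -> (forall t, I t -> 0 <= H t) -> 0 <= kap ->
  (forall t r, I t -> Omega r ->
    sqnormc (V t r) <= kap * sqnormc (W t r) + (if r < 2 then H t else 0)) ->
  (\int[leb]_(t in I) \int[leb]_(r in Omega) (sqnormc (V t r))%:E <=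
   kap%:E * \int[leb]_(t in I) \int[leb]_(r in Omega) (sqnormc (W t r))%:E +
   \int[leb]_(t in I) (H t)%:E)%E.
Proof.
move=> mI IT mW mV mH H0 kap0 VW.
have sq0 (U : R -> R -> R[i]) t : (0 <= \int[leb]_(r in Omega) (sqnormc (U t r))%:E)%E.
  by apply: integral_ge0 => r _; rewrite lee_fin sqnormc_ge0.
have mWI := measurable_L2r_section mI IT mW.
have mVI := measurable_L2r_section mI IT mV.
rewrite -ge0_integralZl// -ge0_integralD//; first last.
- exact/measurable_EFinP.
- by apply: emeasurable_funM.
- by move=> t It; rewrite mule_ge0.
apply: ge0_le_integral => //.
  apply: emeasurable_funD; last exact/measurable_EFinP.
  by apply: emeasurable_funM.
move=> t It; have tT := IT t It.
have mWt := measurable_sqnormc_section tT mW.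
rewrite -(integral_unit_cutoff (H0 t It)) -ge0_integralZl//; first last.
- by move=> r _; rewrite lee_fin sqnormc_ge0.
- exact: measurable_Omega.
rewrite -ge0_integralD//; first last.
- by apply: measurable_unit_cutoff; exact: measurable_Omega.
- by move=> r _; rewrite lee_fin; case: ifP => // _; exact: H0.
- by apply: emeasurable_funM.
- by move=> r _; rewrite mule_ge0// lee_fin sqnormc_ge0.
- exact: measurable_Omega.
apply: ge0_le_integral => //.
- exact: measurable_Omega.
- by move=> r _; rewrite lee_fin sqnormc_ge0.
- exact: measurable_sqnormc_section.
- apply: emeasurable_funD; first by apply: emeasurable_funM.
  by apply: measurable_unit_cutoff; exact: measurable_Omega.
- by move=> r rO; rewrite -EFinM -EFinD lee_fin VW.
Qed.

(** The only source of lower bounds: it gives both the divergence of [||w||] and the positivity of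
    [||f||]. *)
Lemma sqint_rect_ge W (c t1 t2 r1 r2 : R) : 0 <= c -> 0 < t1 -> t1 < t2 ->
  1 < r1 -> r1 < r2 ->
  cmeasurable (Time `*` Omega) (fun z : R * R => W z.1 z.2) ->
  (forall t r, t1 <= t <= t2 -> r1 <= r <= r2 -> c <= sqnormc (W t r)) ->
  ((c * (r2 - r1) * (t2 - t1))%:E <=
   \int[leb]_(t in Time) \int[leb]_(r in Omega) (sqnormc (W t r))%:E)%E.
Proof.
move=> c0 t10 t12 r11 r12 mW cW.
have sq0 t r : (0 <= (sqnormc (W t r))%:E)%E by rewrite lee_fin sqnormc_ge0.
have sI t : (0 <= \int[leb]_(r in Omega) (sqnormc (W t r))%:E)%E.
  by apply: integral_ge0.
have tT : `[t1, t2] `<=` @Time R.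
  by move=> t /=; rewrite /Time/= !in_itv/= andbT => /andP[+ _]; exact: lt_le_trans.
have rO : `[r1, r2] `<=` @Omega R.
  by move=> r /=; rewrite /Omega/= !in_itv/= andbT => /andP[+ _]; exact: lt_le_trans.
have mI := measurable_L2r_section measurable_Time (@subset_refl _ _) mW.
apply: le_trans; last exact: (ge0_subset_integral leb _ measurable_Time mI _ tT).
have cst_itv (k a b : R) : a < b ->
    (\int[leb]_(t in `[a, b]) cst k%:E t)%E = (k * (b - a))%:E.
  move=> ab; rewrite integral_cst//= lebesgue_measure_itv/= lte_fin ab.
  by rewrite -EFinD -EFinM.
rewrite -cst_itv//; apply: ge0_le_integral => //.
- by move=> t _; rewrite lee_fin mulr_ge0// subr_ge0 ltW.
- exact: (measurable_funS measurable_Time tT).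
move=> t /= tt; have Tt : Time t by exact: tT.
have mt := measurable_sqnormc_section Tt mW.
apply: le_trans; last exact: (ge0_subset_integral leb _ measurable_Omega mt _ rO).
rewrite -cst_itv//; apply: ge0_le_integral => //.
- exact: (measurable_funS measurable_Omega rO).
by move=> r /= rr; rewrite lee_fin cW.
Qed.

Lemma continuous_expRM (a : R) : continuous (fun t : R => expR (a * t)).
Proof.
move=> t; apply/differentiable_continuous/derivable1_diffP.
by have [] := is_derive_expRM a t.
Qed.

Lemma integral_exp_decay (C mu : R) : 0 <= C -> 0 < mu ->
  (\int[leb]_(t in Time) (C * expR (- mu * t))%:E < +oo)%E.
Proof.
move=> C0 mu0.
have cf : continuous (fun t => C * expR (- mu * t) : R).
  by move=> t; apply: cvgMr; exact: continuous_expRM.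
pose F (t : R) : R := - (C / mu) * expR (- mu * t).
have dF (t : R) : is_derive t 1 F (C * expR (- mu * t)).
  have := is_derive_expRM (- mu) t => dE.
  apply: (is_derive_eq (is_deriveZ (- (C / mu)) dE)).
  by rewrite /GRing.scale/= mulrA mulrNN divfK// gt_eqF.
rewrite /Time integral_itv_obnd_cbnd; last first.
  apply/measurable_EFinP.
  apply: (measurable_funS measurableT) => //; exact: continuous_measurable_fun.
rewrite (@ge0_continuous_FTC2y _ _ F 0 0)//.
- by rewrite -EFinB ltry.
- by move=> t _; rewrite mulr_ge0 ?expR_ge0.
- exact: continuous_subspaceT.
- rewrite -(mulr0 (- (C / mu))); apply: cvgMr.
  under eq_fun do rewrite mulNr.
  apply: (@cvg_comp _ _ _ (fun t : R => mu * t) (fun z => expR (- z)) _ +oo).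
    by apply: gt0_cvgMry.
  exact: cvgr_expR.
- apply: cvg_at_right_filter; apply/differentiable_continuous/derivable1_diffP.
  by have [] := dF 0.
- by move=> t _; rewrite derive1E; have [_] := dF t.
Qed.

Lemma L2r_bounded u (C : R) : cmeasurable Omega u -> 0 <= C ->
  (forall r, Omega r -> sqnormc (u r) <= if r < 2 then C else 0) -> L2r u.
Proof.
move=> mu C0 uC; split=> //; rewrite L2r_normE -poweR12_sqrt ?poweR_lty//; last first.
  by apply: integral_ge0 => r _; rewrite lee_fin sqnormc_ge0.
apply: le_lt_trans (ltry C); rewrite -(integral_unit_cutoff C0).
apply: ge0_le_integral => //.
- exact: measurable_Omega.
- by move=> r _; rewrite lee_fin sqnormc_ge0.
- exact: measurable_sqnormc.
- by apply: measurable_unit_cutoff; exact: measurable_Omega.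
Qed.

Lemma cvg_sqrte0 T (F : set_system T) {FF : Filter F} (I : T -> \bar R) :
  I x @[x --> F] --> 0%E -> sqrte (I x) @[x --> F] --> 0%E.
Proof.
move=> /fine_cvgP[fI cI]; apply/fine_cvgP; split.
  by apply: filterS fI => x; case: (I x).
rewrite -(@sqrtr0 R); apply: (@cvg_trans _ (Num.sqrt (fine (I x)) @[x --> F])).
  by apply: near_eq_cvg; near=> x; rewrite /=; have : I x \is a fin_num by [near: x]; case: (I x).
by apply: (@cvg_comp _ _ _ (fun x => fine (I x)) Num.sqrt _ _ _ cI); exact: sqrt_continuous.
Unshelve. all: by end_near. Qed.

Lemma L2r_norm_cvg0 (h : nat -> R -> R[i]) (C : R) :
  (forall n, cmeasurable Omega (h n)) -> 0 <= C ->
  (forall n r, Omega r -> sqnormc (h n r) <= if r < 2 then C else 0) ->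
  (forall r, Omega r -> sqnormc (h n r) @[n --> \oo] --> 0) ->
  L2r_norm (h n) @[n --> \oo] --> 0%E.
Proof.
move=> mh C0 hC h0.
under eq_fun do rewrite L2r_normE.
apply: cvg_sqrte0.
have [|||||_ _] := @dominated_convergence _ _ _ leb Omega measurable_Omega
  (fun n r => (sqnormc (h n r))%:E) (cst 0%E)
  (fun r => (if r < 2 then C else 0)%:E).
- by move=> n; exact: (measurable_sqnormc (mh n)).
- exact: measurable_cst.
- by apply: aeW => r rO; apply: cvg_EFin; [exact: nearW|exact: h0].
- apply/integrableP; split.
    by apply: measurable_unit_cutoff; exact: measurable_Omega.
  under eq_integral.
    move=> r _; rewrite gee0_abs; last by rewrite lee_fin; case: ifP.
    over.
  by rewrite integral_unit_cutoff ?ltry.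
- apply: aeW => r n rO; rewrite gee0_abs ?lee_fin ?sqnormc_ge0//.
  exact: hC.
by rewrite integral_cst ?mul0e//; exact: measurable_Omega.
Qed.

End L2_norms.

(** * Weak derivatives and profiles *)

Section weak_derivatives.
Context {R : realType}.
Local Notation leb := (@lebesgue_measure R).
Implicit Types (U V th : R -> R) (c : R).

Lemma test_fun_derivable (I : set R) th : test_fun I th ->
  forall x, derivable th x 1.
Proof. by move=> [dth _] x; exact: (dth 0%N). Qed.

Lemma test_fun_continuous_derive (I : set R) th : test_fun I th ->
  continuous (derive1 th).
Proof.
move=> [dth _] x; apply/differentiable_continuous/derivable1_diffP.
exact: (dth 1%N).
Qed.

(** A compact subset of the open half-line is bounded and keeps a positive distance [e] from [c].
    The points [a] and [b] leave room on both sides, so that [th] vanishes in a neighbourhood of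
    every point outside []a, b[], end points included; this is what makes the derivative vanish
    there too. *)
Lemma test_fun_support c th : test_fun `]c, +oo[%classic th ->
  exists a b, [/\ c < a, a < b &
    forall x, ~~ (a < x < b) -> th x = 0 /\ derive1 th x = 0].
Proof.
move=> [dth [K [cK Kc K0]]].
have clK := compact_closed (@Rhausdorff R) cK.
have /nbhs_ballP[e /= e0 He] : nbhs c (~` K).
  apply: open_nbhs_nbhs; split; first exact: closed_openC.
  by move=> /Kc/=; rewrite in_itv/= ltxx.
have [M [_ /(_ (M + 1))]] := compact_bounded cK.
rewrite ltrDl ltr01 => /(_ isT) HM.
pose a := c + e / 2; pose b := Num.max (a + 1) (M + 2).
exists a, b; split.
- by rewrite ltrDl divr_gt0.
- by rewrite /b lt_max ltrDl ltr01.
- have far x : x < c + e \/ M + 1 < x -> ~ K x \/ x <= c.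
    move=> [xe|xM].
      have [xc|xc] := leP x c; [by right|left].
      apply: He; rewrite /ball/= ltr_distlC; apply/andP; split=> //.
      by rewrite (lt_trans _ xc)// gtrBl.
    left=> /HM; rewrite /= => xM'; have := le_trans (ler_norm x) xM'.
    by rewrite leNgt xM.
  have z x : x < c + e \/ M + 1 < x -> th x = 0.
    move=> /far [nK|xc]; first exact: K0.
    by apply: K0 => /Kc/=; rewrite in_itv/= andbT ltNge xc.
  move=> x; rewrite negb_and -!leNgt => ab.
  have loc : \near x, th x = 0.
    case/orP: ab => [xa|bx].
      near=> y; apply: z; left; near: y; apply: lt_nbhsl.
      by rewrite (le_lt_trans xa)// ltrD2l ltr_pdivrMr// ltr_pMr// ltr1n.
    near=> y; apply: z; right; near: y; apply: lt_nbhsr.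
    by rewrite (lt_le_trans _ bx)// /b lt_max ltrD2l ltr1n orbT.
  split; first exact: nbhs_singleton loc.
  by rewrite derive1E (near_eq_derive (g := cst 0))// derive_cst.
Unshelve. all: by end_near. Qed.

Lemma integration_by_parts_test c U V th :
  test_fun `]c, +oo[%classic th ->
  (forall x, c < x -> is_derive x 1 U (V x)) ->
  (forall x, c < x -> {for x, continuous V}) ->
  \int[leb]_(x in `]c, +oo[) (U x * derive1 th x) =
  - \int[leb]_(x in `]c, +oo[) (V x * th x).
Proof.
move=> tth dU cV; have [a [b [ca ab th0]]] := test_fun_support tth.
have itv (f g : R -> R) : (forall x, ~~ (a < x < b) -> g x = 0) ->
    \int[leb]_(x in `]c, +oo[) (f x * g x) = \int[leb]_(x in `[a, b]) (f x * g x).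
  move=> g0; rewrite Rintegral_mkcond [RHS]Rintegral_mkcond.
  apply: eq_Rintegral => x _; rewrite !patchE.
  have [/set_mem xab|xab] := boolP (x \in `[a, b]%classic).
    rewrite mem_set//=; move: xab; rewrite /= !in_itv/= andbT => /andP[ax _].
    exact: lt_le_trans ax.
  rewrite g0 ?mulr0; first by case: ifP.
  apply: contra xab => /andP[ax xb]; rewrite mem_set//= in_itv/=.
  by rewrite !ltW.
rewrite !itv; [|by move=> x /th0[]..].
have cth x : {for x, continuous th}.
  by apply/differentiable_continuous/derivable1_diffP; exact: test_fun_derivable tth x.
have cU x : c < x -> {for x, continuous U}.
  by move=> /dU[dUx _]; apply/differentiable_continuous/derivable1_diffP.
have [tha _] : th a = 0 /\ derive1 th a = 0 by apply: th0; rewrite ltxx.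
have [thb _] : th b = 0 /\ derive1 th b = 0 by apply: th0; rewrite ltxx andbF.
have cb : c < b by exact: lt_trans ab.
rewrite (@Rintegration_by_parts _ U th V (derive1 th) a b)//.
- by rewrite tha thb !mulr0 subr0 sub0r.
- apply: continuous_in_subspaceT => x /set_mem/=; rewrite in_itv/= => /andP[ax _].
  by apply: cV; exact: lt_le_trans ax.
- split.
  + by move=> x; rewrite in_itv/= => /andP[ax _]; have [] := dU x (lt_trans ca ax).
  + by apply: cvg_at_right_filter; exact: cU.
  + by apply: cvg_at_left_filter; exact: cU.
- by move=> x; rewrite in_itv/= => /andP[ax _]; rewrite derive1E; have [] := dU x (lt_trans ca ax).
- by apply: continuous_subspaceT; exact: test_fun_continuous_derive tth.
- split.
  + by move=> x _; exact: test_fun_derivable tth x.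
  + by apply: cvg_at_right_filter; exact: cth.
  + by apply: cvg_at_left_filter; exact: cth.
Qed.

(** Applied with [c = 1] to weak derivatives in space and with [c = 0] to the time derivative. *)
Lemma cintegration_by_parts_test c (U1 U2 V1 V2 th : R -> R) :
  test_fun `]c, +oo[%classic th ->
  (forall x : R, c < x -> is_derive x 1 U1 (V1 x)) ->
  (forall x : R, c < x -> {for x, continuous V1}) ->
  (forall x : R, c < x -> is_derive x 1 U2 (V2 x)) ->
  (forall x : R, c < x -> {for x, continuous V2}) ->
  cintegral `]c, +oo[%classic (fun r => (U1 r +i* U2 r) * (derive1 th r)%:C)%C =
  - cintegral `]c, +oo[%classic (fun r => (V1 r +i* V2 r) * (th r)%:C)%C.
Proof.
move=> tth dU1 cV1 dU2 cV2; rewrite /cintegral/=.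
have re (f g h : R -> R) : (fun r => f r * h r - g r * 0) = (fun r => f r * h r).
  by apply/funext => r; rewrite mulr0 subr0.
have im (f g h : R -> R) : (fun r => f r * 0 + g r * h r) = (fun r => g r * h r).
  by apply/funext => r; rewrite mulr0 add0r.
rewrite !re !im.
by rewrite (integration_by_parts_test tth dU1 cV1) (integration_by_parts_test tth dU2 cV2).
Qed.

End weak_derivatives.

(** * Polynomial profiles truncated at [r = 2] and their membership in the domain of the operator *)

Section profiles.
Context {R : realType}.
Implicit Types (P S : {poly R}) (r : R).

Definition cut P r : R := if r < 2 then P.[r] else 0.

Definition profile P S r : R[i] := (cut P r +i* cut S r)%C.

(** The root at [1] is the Dirichlet condition. The triple root at [2] makes the extension by zero
    twice continuously differentiable, so that classical derivatives serve as weak ones. *)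
Definition admissible P :=
  [/\ P.[1] = 0, P.[2] = 0, P^`().[2] = 0 & P^`()^`().[2] = 0].

Lemma admissibleZ (a : R) P : admissible P -> admissible (a *: P).
Proof.
by case=> P1 P2 P'2 P''2; split; rewrite ?derivZ hornerZ ?P1 ?P2 ?P'2 ?P''2 mulr0.
Qed.

Lemma profileZ (a : R) P S r : profile (a *: P) (a *: S) r = (a%:C * profile P S r)%C.
Proof.
rewrite /profile /cut; apply/eqP; rewrite eq_complex/=.
by case: ifP => _; rewrite ?hornerZ !mul0r ?mulr0 ?subr0 ?addr0 !eqxx.
Qed.

Lemma is_derive_cut P (x : R) : P.[2] = 0 -> P^`().[2] = 0 ->
  is_derive x 1 (cut P) (cut P^`() x).
Proof.
move=> P2 P'2; rewrite [X in is_derive _ _ _ X]/cut.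
have [x2|x2|->] := ltgtP x 2.
- apply: (@near_eq_is_derive _ _ _ (horner P)).
  near=> y; rewrite /cut ifT//; near: y; exact: lt_nbhsl.
- apply: (@near_eq_is_derive _ _ _ (cst (0:R))).
  near=> y; rewrite /cut ifF//; apply/negbTE; rewrite -leNgt ltW//.
  by near: y; exact: lt_nbhsr.
- apply: (@is_derive_dominated _ _ (horner P)) => //.
    by move=> y; rewrite /cut; case: ifP => // _; rewrite normr0.
  by apply: is_derive_eq.
Unshelve. all: by end_near. Qed.

Lemma continuous_cut P : P.[2] = 0 -> continuous (cut P).
Proof.
move=> P2.
(* Because [P.[2] = 0], truncating at [2] amounts to freezing the argument there. *)
have -> : cut P = horner P \o (fun r => Num.min r 2).
  by apply/funext => r; rewrite /cut /= /Order.min; case: ifP.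
move=> r; apply: (@continuous_comp _ _ _ (fun r : R => Num.min r 2) (horner P)).
  by apply: (@continuous_min _ _ id (cst 2)); [exact: cvg_id|exact: cvg_cst].
exact: continuous_horner.
Qed.

Lemma measurable_cut P (A : set R) : measurable_fun A (cut P).
Proof.
apply: (measurable_funS measurableT) => //.
apply: measurable_fun_ifT => //=; last exact: measurable_poly.
exact: measurable_fun_ltr.
Qed.

Lemma horner_bounded P : exists2 C : R, 0 <= C & forall r, 1 <= r <= 2 -> `|P.[r]| <= C.
Proof.
have [C HC] := poly_disk_bound P 2.
exists (Num.max 0 C); first by rewrite le_max lexx.
move=> r /andP[r1 r2]; rewrite le_max HC ?orbT//.
by rewrite ger0_norm// (le_trans ler01).
Qed.

Lemma horner_root_bounded P a : P.[a] = 0 ->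
  exists2 C : R, 0 <= C & forall r, 1 <= r <= 2 -> `|P.[r]| <= C * `|r - a|.
Proof.
move=> /eqP/factor_theorem[Q ->]; have [C C0 HC] := horner_bounded Q.
exists C => // r r12; rewrite hornerM hornerXsubC normrM ler_wpM2r//.
exact: HC.
Qed.

Lemma cut_bounded P : exists2 C : R, 0 <= C &
  forall r, Omega r -> `|cut P r| <= if r < 2 then C else 0.
Proof.
have [C C0 HC] := horner_bounded P.
exists C => // r; rewrite /Omega/= in_itv/= andbT => r1.
by rewrite /cut; case: ifPn => [r2|_]; rewrite ?normr0// HC// !ltW.
Qed.

Lemma cmeasurable_profile P S (A : set R) : cmeasurable A (profile P S).
Proof. by split; exact: measurable_cut. Qed.

Lemma sqr_le_norm (x c : R) : `|x| <= c -> x ^+ 2 <= c ^+ 2.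
Proof.
move=> xc; rewrite -real_normK ?num_real// ler_sqr ?nnegrE//.
exact: le_trans xc.
Qed.

Lemma L2r_profile P S : L2r (profile P S).
Proof.
have [C C0 HC] := cut_bounded P; have [D D0 HD] := cut_bounded S.
apply: (@L2r_bounded _ _ (C ^+ 2 + D ^+ 2)).
- exact: cmeasurable_profile.
- by rewrite addr_ge0 ?sqr_ge0.
move=> r rO; rewrite /sqnormc/=; have := HC r rO; have := HD r rO.
case: ifP => _ hD hC; first by rewrite lerD ?sqr_le_norm.
by move: hD hC; rewrite !normr_le0 => /eqP -> /eqP ->; rewrite expr0n addr0.
Qed.

Lemma weak_deriv_profile P S : P.[2] = 0 -> P^`().[2] = 0 ->
  S.[2] = 0 -> S^`().[2] = 0 ->
  weak_deriv (profile P S) (profile P^`() S^`()).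
Proof.
move=> P2 P'2 S2 S'2; move=> th tth; apply: cintegration_by_parts_test tth _ _ _ _ => x _.
- exact: is_derive_cut.
- exact: continuous_cut.
- exact: is_derive_cut.
- exact: continuous_cut.
Qed.

Lemma H2r_profile P S : admissible P -> admissible S -> H2r (profile P S).
Proof.
move=> [_ P2 P'2 P''2] [_ S2 S'2 S''2]; split; first exact: L2r_profile.
exists (profile P^`() S^`()), (profile P^`()^`() S^`()^`()).
split; [exact: L2r_profile|exact: L2r_profile| |]; exact: weak_deriv_profile.
Qed.

(** The profile is cut off at both end points of [(1, 2)]. The affine arguments are expanded to
    match the constructor [smooth_flat]; [cutoffE] gives the readable form. *)
Definition cutoff (n : nat) P r : R :=
  P.[r] * flat 1 (n%:R * r + (- n%:R - 1)) * flat 1 (- n%:R * r + (n%:R * 2 - 1)).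

Definition cutoff_deriv (n : nat) P r : R :=
  P^`().[r] * (flat 1 (n%:R * (r - 1) - 1) * flat 1 (n%:R * (2 - r) - 1)) +
  P.[r] * (n%:R * flat 'X^2 (n%:R * (r - 1) - 1)) * flat 1 (n%:R * (2 - r) - 1) -
  P.[r] * (n%:R * flat 'X^2 (n%:R * (2 - r) - 1)) * flat 1 (n%:R * (r - 1) - 1).

Lemma cutoffE n P r : cutoff n P r =
  P.[r] * (flat 1 (n%:R * (r - 1) - 1) * flat 1 (n%:R * (2 - r) - 1)).
Proof. by rewrite /cutoff mulrA; do 2?[congr (_ * _)]; congr flat; ring. Qed.

Lemma is_derive_cutoff n P r : is_derive r 1 (cutoff n P) (cutoff_deriv n P r).
Proof.
have dP := is_derive_poly P r.
have dA := @is_derive_flat_affine _ 1 n%:R (- n%:R - 1) r.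
have dB := @is_derive_flat_affine _ 1 (- n%:R) (n%:R * 2 - 1) r.
apply: (is_derive_eq (is_deriveM (is_deriveM dP dA) dB)).
rewrite /cutoff_deriv /GRing.scale/= derivC subr0 mulr1 fctE.
have -> : n%:R * r + (- n%:R - 1) = n%:R * (r - 1) - 1 :> R by ring.
have -> : - n%:R * r + (n%:R * 2 - 1) = n%:R * (2 - r) - 1 :> R by ring.
by ring.
Qed.

Lemma test_fun_cutoff n P : test_fun Omega (cutoff n P).
Proof.
split.
  apply: smooth_class_derivable; apply: smooth_mul; last exact: smooth_flat.
  by apply: smooth_mul; [exact: smooth_horner|exact: smooth_flat].
(* The set only has to contain the support, which lies in [r >= 1 + n^-1] for [n > 0]; [n.+1] also
   covers [n = 0], where the cutoff is identically zero. *)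
exists `[1 + (n.+1%:R)^-1, 2]%classic; split.
- exact: segment_compact.
- move=> r /=; rewrite /Omega/= !in_itv/= andbT => /andP[+ _]; apply: lt_le_trans.
  by rewrite ltrDl invr_gt0.
move=> r /=; rewrite in_itv/= => /negP; rewrite negb_and -!ltNge cutoffE.
case/orP => h.
  rewrite (flat_le0 _ (x := _ * (r - 1) - 1)) ?mul0r ?mulr0// subr_le0.
  have h1 : r - 1 < (n.+1%:R)^-1 by rewrite ltrBlDl.
  have [r1|r1] := leP (r - 1) 0.
    by rewrite (le_trans _ ler01)// mulr_ge0_le0.
  apply: (@le_trans _ _ (n.+1%:R * (r - 1))).
    by apply: ler_wpM2r; [exact: ltW|rewrite ler_nat].
  by rewrite -ler_pdivlMl// mulr1 ltW.
rewrite (flat_le0 _ (x := _ * (2 - r) - 1)) ?mulr0// subr_le0.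
by rewrite (le_trans _ ler01)// mulr_ge0_le0// subr_le0 ltW.
Qed.

Lemma flat_ge2 Q (n : nat) r : 2 <= r -> flat Q (n%:R * (2 - r) - 1) = 0.
Proof.
move=> r2; rewrite flat_le0// subr_le0 (le_trans _ ler01)//.
by rewrite mulr_ge0_le0// subr_le0.
Qed.

Lemma flat1_mul_bounds (x y : R) : 0 <= flat 1 x * flat 1 y <= 1.
Proof.
have /andP[x0 x1] := flat1_bounds x; have /andP[y0 y1] := flat1_bounds y.
by rewrite mulr_ge0//= mulr_ile1.
Qed.

Lemma cutoff_bound P : exists2 C : R, 0 <= C & forall n r, Omega r ->
  `|cutoff n P r - cut P r| <= if r < 2 then C else 0.
Proof.
have [C C0 HC] := horner_bounded P; exists C => // n r.
rewrite /Omega/= in_itv/= andbT => r1; rewrite cutoffE /cut.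
case: ltP => r2; last by rewrite flat_ge2// !mulr0 subr0 normr0.
rewrite -[X in _ - X]mulr1 -mulrBr normrM -[leRHS]mulr1 ler_pM//.
  by rewrite HC// !ltW.
have /andP[f0 f1] := flat1_mul_bounds (n%:R * (r - 1) - 1) (n%:R * (2 - r) - 1).
by rewrite ler_norml; apply/andP; split; lra.
Qed.

Lemma cutoff_cvg P r : Omega r -> cutoff n P r - cut P r @[n --> \oo] --> (0:R).
Proof.
rewrite /Omega/= in_itv/= andbT => r1.
under eq_fun do rewrite cutoffE.
rewrite -(subrr (cut P r)); apply: cvgB; last exact: cvg_cst.
rewrite /cut; case: ltP => r2; last first.
  by under eq_fun do rewrite flat_ge2// !mulr0; exact: cvg_cst.
rewrite -[X in _ --> X]mulr1; apply: cvgMr.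
rewrite -[X in _ --> X](mulr1 1); apply: cvgM; apply: cvg_flat1;
  by rewrite subr_gt0.
Qed.

(** The bound is uniform in [n]: the roots of [P] at [1] and [2] supply the factors [r - 1] and
    [2 - r] that [flat_derive_scale] needs. It provides the domination for convergence of the
    derivatives in [L^2]. *)
Lemma cutoff_deriv_bound P : P.[1] = 0 -> P.[2] = 0 ->
  exists2 C : R, 0 <= C & forall n r, Omega r ->
  `|cutoff_deriv n P r - cut P^`() r| <= if r < 2 then C else 0.
Proof.
move=> P1 P2.
have [C C0 HC] := horner_bounded P^`().
have [C1 C10 HC1] := horner_root_bounded P1.
have [C2 C20 HC2] := horner_root_bounded P2.
have [D D0 HD] := flat_bounded ('X + 'X^2 : {poly R}).
exists (C + C1 * D + C2 * D); first by rewrite !addr_ge0// mulr_ge0.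
move=> n r; rewrite /Omega/= in_itv/= andbT => r1; rewrite /cutoff_deriv /cut.
case: ltP => r2; last by rewrite !flat_ge2// !(mulr0,mul0r) addr0 !subr0 normr0.
have r12 : 1 <= r <= 2 by rewrite !ltW.
set a := flat 1 (n%:R * (r - 1) - 1); set b := flat 1 (n%:R * (2 - r) - 1).
set A := n%:R * flat 'X^2 (n%:R * (r - 1) - 1).
set B := n%:R * flat 'X^2 (n%:R * (2 - r) - 1).
have PA : `|P.[r] * A| <= C1 * D.
  rewrite normrM (le_trans (ler_wpM2r _ (HC1 r r12)))// -mulrA -normrM.
  by rewrite ler_wpM2l// /A flat_derive_scale.
have PB : `|P.[r] * B| <= C2 * D.
  rewrite normrM (le_trans (ler_wpM2r _ (HC2 r r12)))// -mulrA -normrM.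
  by rewrite -normrN -mulNr opprB ler_wpM2l// /B flat_derive_scale.
have /andP[a0 a1] : 0 <= a <= 1 by exact: flat1_bounds.
have /andP[b0 b1] : 0 <= b <= 1 by exact: flat1_bounds.
have /andP[ab0 ab1] : 0 <= a * b <= 1 by exact: flat1_mul_bounds.
have -> : P^`().[r] * (a * b) + P.[r] * A * b - P.[r] * B * a - P^`().[r] =
  P^`().[r] * (a * b - 1) + P.[r] * A * b - P.[r] * B * a by ring.
rewrite (le_trans (ler_normB _ _))// lerD//.
  rewrite (le_trans (ler_normD _ _))// lerD//.
    rewrite normrM -[leRHS]mulr1 ler_pM ?HC//.
    by rewrite ler_norml; apply/andP; split; lra.
  by rewrite normrM -[leRHS]mulr1 ler_pM// ger0_norm.
by rewrite normrM -[leRHS]mulr1 ler_pM// ger0_norm.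
Qed.

Lemma cutoff_deriv_cvg P r : Omega r ->
  cutoff_deriv n P r - cut P^`() r @[n --> \oo] --> (0:R).
Proof.
rewrite /Omega/= in_itv/= andbT => r1.
rewrite -(subrr (cut P^`() r)); apply: cvgB; last exact: cvg_cst.
rewrite /cut /cutoff_deriv; case: ltP => r2; last first.
  under eq_fun do rewrite !flat_ge2// !(mulr0,mul0r) subr0 addr0.
  exact: cvg_cst.
have r10 : 0 < r - 1 by rewrite subr_gt0.
have r20 : 0 < 2 - r by rewrite subr_gt0.
rewrite -[X in _ --> X]subr0; apply: cvgB.
  rewrite -[X in _ --> X]addr0; apply: cvgD.
    rewrite -[X in _ --> X]mulr1; apply: cvgMr.
    by rewrite -[X in _ --> X](mulr1 1); apply: cvgM; exact: cvg_flat1.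
  rewrite -(mul0r 1); apply: cvgM; last exact: cvg_flat1.
  by rewrite -(mulr0 P.[r]); apply: cvgMr; exact: cvg_flat_derive.
rewrite -(mul0r 1); apply: cvgM; last exact: cvg_flat1.
by rewrite -(mulr0 P.[r]); apply: cvgMr; exact: cvg_flat_derive.
Qed.

Lemma L2r_norm_ReIm_cvg0 (a b : nat -> R -> R) (C D : R) :
  (forall n, measurable_fun Omega (a n)) -> (forall n, measurable_fun Omega (b n)) ->
  0 <= C -> 0 <= D ->
  (forall n r, Omega r -> `|a n r| <= if r < 2 then C else 0) ->
  (forall n r, Omega r -> `|b n r| <= if r < 2 then D else 0) ->
  (forall r, Omega r -> a n r @[n --> \oo] --> (0:R)) ->
  (forall r, Omega r -> b n r @[n --> \oo] --> (0:R)) ->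
  L2r_norm (fun r => (a n r +i* b n r)%C) @[n --> \oo] --> 0%E.
Proof.
move=> ma mb C0 D0 aC bD ca cb; apply: (@L2r_norm_cvg0 _ _ (C ^+ 2 + D ^+ 2)).
- by move=> n; split; [exact: ma|exact: mb].
- by rewrite addr_ge0 ?sqr_ge0.
- move=> n r rO; rewrite /sqnormc/=; have := aC n r rO; have := bD n r rO.
  case: ifP => _ hD hC; first by rewrite lerD ?sqr_le_norm.
  by move: hD hC; rewrite !normr_le0 => /eqP -> /eqP ->; rewrite expr0n addr0.
- have sq (c : nat -> R) : c n @[n --> \oo] --> (0:R) -> c n ^+ 2 @[n --> \oo] --> (0:R).
    by move=> h; rewrite -[X in _ --> X](mulr0 0); exact: (cvgM h h).
  move=> r rO; rewrite /sqnormc/= -[X in _ --> X](addr0 0).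
  by apply: cvgD; apply: sq; [exact: ca|exact: cb].
Qed.

Lemma derive_cutoff n P : derive1 (cutoff n P) = cutoff_deriv n P.
Proof.
by apply/funext => r; rewrite derive1E; have [_] := is_derive_cutoff n P r.
Qed.

Lemma measurable_cutoff n P : measurable_fun Omega (cutoff n P).
Proof.
apply: (measurable_funS measurableT) => //; apply: continuous_measurable_fun => r.
by apply/differentiable_continuous/derivable1_diffP; have [] := is_derive_cutoff n P r.
Qed.

Lemma measurable_cutoff_deriv n P : measurable_fun Omega (cutoff_deriv n P).
Proof.
apply: (measurable_funS measurableT) => //; apply: continuous_measurable_fun => r.
rewrite -derive_cutoff; exact: (test_fun_continuous_derive (test_fun_cutoff n P)).
Qed.

Lemma H10r_profile P S : admissible P -> admissible S -> H10r (profile P S).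
Proof.
move=> [P1 P2 P'2 _] [S1 S2 S'2 _]; split; first exact: L2r_profile.
exists (profile P^`() S^`()); split; first exact: L2r_profile.
  exact: weak_deriv_profile.
exists (fun n => cutoff n P), (fun n => cutoff n S); split.
- by move=> n; split; exact: test_fun_cutoff.
- have [C C0 HC] := cutoff_bound P; have [D D0 HD] := cutoff_bound S.
  apply: (@L2r_norm_ReIm_cvg0 (fun n r => cutoff n P r - cut P r)
    (fun n r => cutoff n S r - cut S r) C D) => //.
  + by move=> n; apply: measurable_funB; [exact: measurable_cutoff|exact: measurable_cut].
  + by move=> n; apply: measurable_funB; [exact: measurable_cutoff|exact: measurable_cut].
  + by move=> r; exact: cutoff_cvg.
  + by move=> r; exact: cutoff_cvg.
- have [C C0 HC] := cutoff_deriv_bound P1 P2.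
  have [D D0 HD] := cutoff_deriv_bound S1 S2.
  under eq_fun do rewrite !derive_cutoff.
  apply: (@L2r_norm_ReIm_cvg0 (fun n r => cutoff_deriv n P r - cut P^`() r)
    (fun n r => cutoff_deriv n S r - cut S^`() r) C D) => //.
  + by move=> n; apply: measurable_funB; [exact: measurable_cutoff_deriv|exact: measurable_cut].
  + by move=> n; apply: measurable_funB; [exact: measurable_cutoff_deriv|exact: measurable_cut].
  + by move=> r; exact: cutoff_deriv_cvg.
  + by move=> r; exact: cutoff_deriv_cvg.
Qed.

Lemma domT_profile P S : admissible P -> admissible S -> domT (profile P S).
Proof. by move=> aP aS; split; [exact: H2r_profile|exact: H10r_profile]. Qed.

End profiles.

(** * Separated solutions *)

Section separated_solutions.
Context {R : realType}.
Local Notation leb := (@lebesgue_measure R).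
Implicit Types (a b : R -> R) (X Y : R -> R) (P S : {poly R}).

Lemma measurable_fst_comp X : continuous X ->
  measurable_fun (Time `*` Omega) (fun z : R * R => X z.1).
Proof.
move=> cX; apply: (measurable_funS measurableT) => //.
apply: (measurableT_comp (f := X)); last exact: measurable_fst.
exact: continuous_measurable_fun.
Qed.

Lemma measurable_snd_comp a : measurable_fun Omega a ->
  measurable_fun (Time `*` Omega) (fun z : R * R => a z.2).
Proof.
move=> /(measurable_restrictT _ measurable_Omega).1 ma.
have : measurable_fun (Time `*` Omega) ((a \_ Omega) \o snd : R * R -> R).
  apply: (measurable_funS measurableT) => //.
  by apply: measurableT_comp => //; exact: measurable_snd.
apply: eq_measurable_fun => z /set_mem[_ zO] /=.
by rewrite patchE mem_set.
Qed.

Definition cut_bounded_fun a := measurable_fun Omega a /\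
  exists2 C : R, 0 <= C & forall r, Omega r -> `|a r| <= if r < 2 then C else 0.

Lemma cut_bounded_cut P : cut_bounded_fun (cut P).
Proof.
by split; [exact: measurable_cut|exact: cut_bounded].
Qed.

Lemma cut_bounded_add a b : cut_bounded_fun a -> cut_bounded_fun b ->
  cut_bounded_fun (fun r => a r + b r).
Proof.
move=> [ma [C C0 aC]] [mb [D D0 bD]]; split; first exact: measurable_funD.
exists (C + D); first exact: addr_ge0.
move=> r rO; rewrite (le_trans (ler_normD _ _))//.
have := aC r rO; have := bD r rO; case: ifP => _; first by move=> *; exact: lerD.
by move=> hb ha; rewrite -(addr0 0) lerD.
Qed.

Lemma cut_bounded_mul (c : R -> R) a : measurable_fun Omega c ->
  (exists K : R, forall r, Omega r -> `|c r| <= K) -> cut_bounded_fun a ->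
  cut_bounded_fun (fun r => c r * a r).
Proof.
move=> mc [K cK] [ma [C C0 aC]]; split; first exact: measurable_funM.
exists (Num.max 0 K * C); first by rewrite mulr_ge0// le_max lexx.
move=> r rO; rewrite normrM; have := aC r rO; case: ifP => _ h.
  by rewrite ler_pM// le_max cK ?orbT.
by move: h; rewrite normr_le0 => /eqP ->; rewrite normr0 mulr0.
Qed.

(** Two separated terms are needed because the source has the form [X' g + X (T g)]; the solution is
    the case where the second term vanishes. *)
Definition separated X Y a b a' b' (t r : R) : R[i] :=
  ((X t * a r + Y t * a' r) +i* (X t * b r + Y t * b' r))%C.

Lemma cmeasurable_separated X Y a b a' b' : continuous X -> continuous Y ->
  measurable_fun Omega a -> measurable_fun Omega b ->
  measurable_fun Omega a' -> measurable_fun Omega b' ->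
  cmeasurable (Time `*` Omega) (fun z : R * R => separated X Y a b a' b' z.1 z.2).
Proof.
move=> cX cY ma mb ma' mb'; split => /=; apply: measurable_funD;
  apply: measurable_funM; (try exact: measurable_fst_comp); exact: measurable_snd_comp.
Qed.

Lemma continuous_bounded_itv X (T : R) : continuous X -> 0 < T ->
  exists2 M : R, 0 <= M & forall t, 0 < t < T -> `|X t| <= M.
Proof.
move=> cX T0.
have cN : {within `[0, T], continuous (fun t => `|X t|)}.
  by apply: continuous_subspaceT => t; apply: cvg_norm; exact: cX.
have [c _ Hc] := EVT_max (ltW T0) cN.
by exists `|X c| => // t /andP[t0 tT]; apply: Hc; rewrite in_itv/= !ltW.
Qed.

Lemma L2loc_separated X Y a b a' b' : continuous X -> continuous Y ->
  cut_bounded_fun a -> cut_bounded_fun b ->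
  cut_bounded_fun a' -> cut_bounded_fun b' ->
  L2loc (separated X Y a b a' b').
Proof.
move=> cX cY [ma [A A0 aA]] [mb [B B0 bB]] [ma' [A' A'0 aA']] [mb' [B' B'0 bB']].
have mW := cmeasurable_separated cX cY ma mb ma' mb'.
split=> // T T0.
have [M M0 HM] := continuous_bounded_itv cX T0.
have [N N0 HN] := continuous_bounded_itv cY T0.
rewrite L2t_normE -poweR12_sqrt; last first.
  apply: integral_ge0 => t _; apply: integral_ge0 => r _.
  by rewrite lee_fin sqnormc_ge0.
apply: poweR_lty.
pose C := (M * A + N * A') ^+ 2 + (M * B + N * B') ^+ 2.
have C0 : 0 <= C by rewrite addr_ge0 ?sqr_ge0.
have IT : `]0%R, T[%classic `<=` @Time R.
  by move=> t /=; rewrite /Time/= !in_itv/= andbT => /andP[].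
apply: le_lt_trans (sqint_le (W := fun _ _ => 0%C) (kap := 0) (H := cst C) _ IT _ mW _ _ _ _) _ => //.
- move=> t r /=; rewrite in_itv/= => tT rO; rewrite mul0r add0r /sqnormc/=.
  have := aA r rO; have := bB r rO; have := aA' r rO; have := bB' r rO.
  have Xt := HM t tT; have Yt := HN t tT.
  case: ifP => _ hB' hA' hB hA.
    by rewrite lerD// sqr_le_norm// (le_trans (ler_normD _ _))// !normrM lerD// ler_pM.
  by move: hB' hA' hB hA; rewrite !normr_le0 => /eqP -> /eqP -> /eqP -> /eqP ->;
    rewrite !mulr0 !addr0 expr0n addr0.
rewrite mul0e add0e [X in (X < _)%E](_ : _ = C%:E * leb `]0%R, T[%classic)%E; last first.
  by rewrite -integral_cst.
rewrite lebesgue_measure_itv/= lte_fin T0.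
by rewrite -EFinD -EFinM ltry.
Qed.

Variables (k : int) (nu B : R).

Definition opT_re P S (r : R) : R :=
  - nu * (cut P^`()^`() r - (k%:~R ^+ 2 - 4^-1) / r ^+ 2 * cut P r) -
  k%:~R * B / r ^+ 2 * cut S r.

Definition opT_im P S (r : R) : R :=
  - nu * (cut S^`()^`() r - (k%:~R ^+ 2 - 4^-1) / r ^+ 2 * cut S r) +
  k%:~R * B / r ^+ 2 * cut P r.

Definition sep_w X P S (t r : R) : R[i] := ((X t)%:C * profile P S r)%C.

Definition sep_f X Y P S : R -> R -> R[i] :=
  separated Y X (cut P) (cut S) (opT_re P S) (opT_im P S).

Lemma sep_wE X P S : sep_w X P S = separated X (cst 0) (cut P) (cut S) (cst 0) (cst 0).
Proof.
apply/funext => t; apply/funext => r; apply/eqP; rewrite eq_complex/=.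
by rewrite !mul0r subr0 !addr0 !eqxx.
Qed.

Lemma sep_fE X Y P S t r : sep_w Y P S t r +
  opT k nu B (sep_w X P S t) (sep_w X P^`()^`() S^`()^`() t) r = sep_f X Y P S t r.
Proof.
apply/eqP; rewrite eq_complex/= /opT_re /opT_im.
by apply/andP; split; apply/eqP; ring.
Qed.

Lemma inv_sqr_bounded (c : R) :
  measurable_fun Omega (fun r : R => c / r ^+ 2) /\
  exists K : R, forall r, Omega r -> `|c / r ^+ 2| <= K.
Proof.
split.
  apply: open_continuous_measurable_fun; first exact: interval_open.
  move=> r /set_mem; rewrite /Omega/= in_itv/= andbT => r1.
  apply: cvgMr; apply: (@continuousV _ _ (fun r : R => r ^+ 2)).
    by rewrite expf_neq0// gt_eqF// (lt_trans ltr01).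
  exact: exprn_continuous.
exists `|c| => r; rewrite /Omega/= in_itv/= andbT => r1.
have r2 : 1 <= r ^+ 2 by apply: exprn_ege1; exact: ltW.
have r20 : 0 < r ^+ 2 by exact: lt_le_trans r2.
rewrite normrM -[leRHS]mulr1; apply: ler_wpM2l => //.
by rewrite normfV gtr0_norm// invf_le1.
Qed.

Lemma cut_bounded_opT_re P S : cut_bounded_fun (opT_re P S).
Proof.
have [m0 b0] := inv_sqr_bounded (k%:~R ^+ 2 - 4^-1).
have [m1 b1] := inv_sqr_bounded (- (k%:~R * B)).
have -> : opT_re P S = (fun r : R => - nu * (cut P^`()^`() r +
    - 1 * ((k%:~R ^+ 2 - 4^-1) / r ^+ 2 * cut P r)) +
    - (k%:~R * B) / r ^+ 2 * cut S r).
  by apply/funext => r; rewrite /opT_re; ring.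
apply: cut_bounded_add; last first.
  by apply: cut_bounded_mul => //; exact: cut_bounded_cut.
apply: cut_bounded_mul => //; first by exists `|- nu|.
apply: cut_bounded_add; first exact: cut_bounded_cut.
apply: cut_bounded_mul => //; first by exists `|- 1|.
by apply: cut_bounded_mul => //; exact: cut_bounded_cut.
Qed.

Lemma cut_bounded_opT_im P S : cut_bounded_fun (opT_im P S).
Proof.
have [m0 b0] := inv_sqr_bounded (k%:~R ^+ 2 - 4^-1).
have [m1 b1] := inv_sqr_bounded (k%:~R * B).
have -> : opT_im P S = (fun r : R => - nu * (cut S^`()^`() r +
    - 1 * ((k%:~R ^+ 2 - 4^-1) / r ^+ 2 * cut S r)) +
    (k%:~R * B) / r ^+ 2 * cut P r).
  by apply/funext => r; rewrite /opT_im; ring.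
apply: cut_bounded_add; last first.
  by apply: cut_bounded_mul => //; exact: cut_bounded_cut.
apply: cut_bounded_mul => //; first by exists `|- nu|.
apply: cut_bounded_add; first exact: cut_bounded_cut.
apply: cut_bounded_mul => //; first by exists `|- 1|.
by apply: cut_bounded_mul => //; exact: cut_bounded_cut.
Qed.

Lemma cut_bounded_0 : cut_bounded_fun (cst 0).
Proof.
by split; [exact: measurable_cst|exists 0 => // r _; rewrite normr0; case: ifP].
Qed.

Lemma L2loc_sep_w X P S : continuous X -> L2loc (sep_w X P S).
Proof.
move=> cX; rewrite sep_wE; apply: L2loc_separated => //.
- by move=> t; exact: cvg_cst.
- exact: cut_bounded_cut.
- exact: cut_bounded_cut.
- exact: cut_bounded_0.
- exact: cut_bounded_0.
Qed.

Lemma L2loc_sep_f X Y P S : continuous X -> continuous Y -> L2loc (sep_f X Y P S).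
Proof.
move=> cX cY; apply: L2loc_separated => //.
- exact: cut_bounded_cut.
- exact: cut_bounded_cut.
- exact: cut_bounded_opT_re.
- exact: cut_bounded_opT_im.
Qed.

Lemma sep_w_profile X P S t : sep_w X P S t = profile (X t *: P) (X t *: S).
Proof. by apply/funext => r; rewrite profileZ. Qed.

Lemma contL2_sep_w X P S : continuous X -> contL2 (sep_w X P S).
Proof.
move=> cX; split=> [t _|t0 _]; first by rewrite sep_w_profile; exact: L2r_profile.
have dE t r : sep_w X P S t r - sep_w X P S t0 r =
    ((X t - X t0)%:C * profile P S r)%C.
  by rewrite /sep_w -mulrBl -rmorphB.
have [mP _] := L2r_profile P S.
have I0 : (0 <= \int[leb]_(r in Omega) (sqnormc (profile P S r))%:E)%E.
  by apply: integral_ge0 => r _; rewrite lee_fin sqnormc_ge0.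
have := (L2r_profile P S).2; rewrite L2r_normE -poweR12_sqrt// => /lty_poweRy.
rewrite invr_eq0 pnatr_eq0 => /(_ isT) Ioo.
have [c Ic] : exists c, (\int[leb]_(r in Omega) (sqnormc (profile P S r))%:E = c%:E)%E.
  by exists (fine (\int[leb]_(r in Omega) (sqnormc (profile P S r))%:E)%E); rewrite fineK// ge0_fin_numE.
under eq_fun => t.
  rewrite L2r_normE; under eq_integral do rewrite dE sqnormcZ EFinM.
  rewrite ge0_integralZl//; last 4 first.
  - exact: measurable_Omega.
  - exact: measurable_sqnormc.
  - by move=> r _; rewrite lee_fin sqnormc_ge0.
  - by rewrite lee_fin sqr_ge0.
  rewrite Ic -EFinM; over.
apply: cvg_sqrte0; apply: cvg_EFin; first exact: nearW.
rewrite -[X in _ --> X](mul0r c); apply: cvgMl.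
have h : X t - X t0 @[t --> within `[0, +oo[ (nbhs t0)] --> (0:R).
  rewrite -[X in _ --> X](subrr (X t0)); apply: cvgB; last exact: cvg_cst.
  by apply: cvg_within_filter; exact: cX.
by rewrite -[X in _ --> X](mulr0 0); exact: (cvgM h h).
Qed.

Lemma strong_solution_separated X Y P S : admissible P -> admissible S ->
  (forall t : R, is_derive t 1 X (Y t)) -> continuous Y -> X 0 = 0 ->
  strong_solution k nu B (sep_w X P S) (sep_f X Y P S).
Proof.
move=> aP aS dX cY X0.
have cX : continuous X.
  by move=> t; apply/differentiable_continuous/derivable1_diffP; have [] := dX t.
split.
- exact: L2loc_sep_f.
- exact: contL2_sep_w.
- by apply: aeW => r _; rewrite /sep_w X0 mul0r.
exists (sep_w X P^`() S^`()), (sep_w X P^`()^`() S^`()^`()), (sep_w Y P S); split.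
- split; [exact: L2loc_sep_w..|].
  (* At fixed [t] the slice is again a profile, that of the scaled polynomials, so stability of
     [domT] under scaling comes from [admissibleZ]. *)
  apply: aeW => t _; rewrite !sep_w_profile -!derivZ.
  have [_ P2 P'2 P''2] := admissibleZ (X t) aP.
  have [_ S2 S'2 S''2] := admissibleZ (X t) aS.
  split; [|exact: weak_deriv_profile..].
  by apply: domT_profile; exact: admissibleZ.
- exact: L2loc_sep_w.
- move=> th tth; apply: aeW => r _.
  have sE Z : (fun t => sep_w Z P S t r) = (fun t => (Z t * cut P r +i* (Z t * cut S r))%C).
    apply/funext => t; rewrite sep_wE /separated/=.
    by rewrite !mul0r !addr0.
  have := @cintegration_by_parts_test R 0 (fun t => X t * cut P r) (fun t => X t * cut S r)
    (fun t => Y t * cut P r) (fun t => Y t * cut S r) th tth.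
  have dXc (c t : R) : is_derive t 1 (fun t => X t * c) (Y t * c).
    have := is_deriveZ c (dX t).
    by under eq_fun do rewrite /GRing.scale/= mulrC; rewrite /GRing.scale/= mulrC.
  have cYc (c : R) : continuous (fun t => Y t * c).
    by move=> t; apply: cvgMl; exact: cY.
  move=> /(_ (fun t _ => dXc _ t) (fun t _ => cYc _ t) (fun t _ => dXc _ t) (fun t _ => cYc _ t)).
  rewrite /Time.
  have E Z (h : R -> R) : (fun t => sep_w Z P S t r * (h t)%:C)%C =
      (fun t => (Z t * cut P r +i* (Z t * cut S r)) * (h t)%:C)%C.
    by apply/funext => t; have := congr1 (fun f => f t) (sE Z) => /= ->.
  by rewrite !E.
- by apply: aeW => t _; apply: aeW => r _; exact: sep_fE.
Qed.

End separated_solutions.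

(** * Time profile *)

Section time_profile.
Context {R : realType}.
Implicit Types (p q : {poly R}) (t y : R).

Definition chi (eps y : R) := (y - 1) / (1 + eps * y ^+ 2).
(** A common majorant: for [y >= 1] it bounds [chi] and, up to the factor [3 * mu], also [dchi],
    which does not vanish at [y = 1] where [chi] does. *)
Definition psi (eps y : R) := y / (1 + eps * y ^+ 2).
(** The time derivative of [chi] along [y = e^(mu t)], that is [mu y] times the derivative of [chi]
    in [y]. *)
Definition dchi (mu eps y : R) :=
  mu * y * (1 - eps * y ^+ 2 + 2 * eps * y) / (1 + eps * y ^+ 2) ^+ 2.

Lemma is_derive_ratio p q (mu t : R) : q.[expR (mu * t)] != 0 ->
  is_derive t 1 (fun s => p.[expR (mu * s)] / q.[expR (mu * s)])
    (mu * expR (mu * t) *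
     (p^`().[expR (mu * t)] * q.[expR (mu * t)] -
      p.[expR (mu * t)] * q^`().[expR (mu * t)]) / q.[expR (mu * t)] ^+ 2).
Proof.
move=> q0; have dE := is_derive_expRM mu t.
have dp : is_derive t 1 (fun s => p.[expR (mu * s)])
    (p^`().[expR (mu * t)] * (mu * expR (mu * t))).
  exact: (@is_derive1_comp _ (horner p) (fun s => expR (mu * s))).
have dq : is_derive t 1 (fun s => q.[expR (mu * s)])
    (q^`().[expR (mu * t)] * (mu * expR (mu * t))).
  exact: (@is_derive1_comp _ (horner q) (fun s => expR (mu * s))).
have dqV := @is_deriveV _ (fun s => q.[expR (mu * s)]) t _ _ q0 dq.
apply: (is_derive_eq (is_deriveM dp dqV)); rewrite /GRing.scale/=.
by field.
Qed.

Lemma den_gt0 (eps y : R) : 0 < eps -> 0 < 1 + eps * y ^+ 2.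
Proof. by move=> e0; rewrite ltr_pwDl// mulr_ge0 ?sqr_ge0// ltW. Qed.

Lemma is_derive_chi (mu eps t : R) : 0 < eps ->
  is_derive t 1 (fun s => chi eps (expR (mu * s))) (dchi mu eps (expR (mu * t))).
Proof.
move=> e0; pose q : {poly R} := 1 + eps *: 'X^2.
have qE y : q.[y] = 1 + eps * y ^+ 2 by rewrite /q !(hornerE,hornerXn).
have q0 : q.[expR (mu * t)] != 0 by rewrite qE gt_eqF// den_gt0.
have := is_derive_ratio ('X - 1%:P) q0.
under eq_fun do rewrite hornerXsubC qE.
rewrite derivXsubC hornerXsubC qE => h; apply: (is_derive_eq h).
rewrite /dchi /q derivD derivC add0r derivZ derivXn hornerZ hornerMn hornerXn hornerC.
by congr (_ / _); ring.
Qed.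

Lemma continuous_dchi (mu eps : R) : 0 < eps ->
  continuous (fun t => dchi mu eps (expR (mu * t))).
Proof.
move=> e0; pose q : {poly R} := (1 + eps *: 'X^2) ^+ 2.
have qE y : q.[y] = (1 + eps * y ^+ 2) ^+ 2.
  by rewrite /q horner_exp !(hornerE,hornerXn).
pose p : {poly R} := mu *: ('X * (1 - eps *: 'X^2 + (2 * eps) *: 'X)).
have pE y : p.[y] = mu * y * (1 - eps * y ^+ 2 + 2 * eps * y).
  by rewrite /p hornerZ hornerM hornerX !hornerD hornerN !hornerZ hornerXn hornerX hornerC; ring.
have -> : (fun t => dchi mu eps (expR (mu * t))) =
    (fun t => p.[expR (mu * t)] / q.[expR (mu * t)]).
  by apply/funext => t; rewrite pE qE.
move=> t; apply/differentiable_continuous/derivable1_diffP.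
have q0 : q.[expR (mu * t)] != 0 by rewrite qE expf_neq0// gt_eqF// den_gt0.
by have [] := is_derive_ratio p q0.
Qed.

Lemma chi_psi (eps y : R) : 0 < eps -> 1 <= y -> 0 <= chi eps y <= psi eps y.
Proof.
move=> e0 y1; have d0 := den_gt0 y e0; rewrite /chi /psi.
apply/andP; split; first by apply: divr_ge0; [rewrite subr_ge0|exact: ltW].
by rewrite ler_pM2r ?invr_gt0// gerBl.
Qed.

(** For [y >= 1] one has [eps y <= eps y^2], so the bracket in the numerator is at most
    [3 (1 + eps y^2)] in modulus. The constant does not depend on [eps]. *)
Lemma dchi_bound (mu eps y : R) : 0 < mu -> 0 < eps -> 1 <= y ->
  `|dchi mu eps y| <= 3 * mu * psi eps y.
Proof.
move=> mu0 e0 y1; have d0 := den_gt0 y e0; rewrite /dchi /psi.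
have y0 : 0 < y by exact: lt_le_trans y1.
rewrite normrM normfV [X in _ / X]gtr0_norm ?exprn_gt0//.
rewrite ler_pdivrMr ?exprn_gt0// normrM gtr0_norm ?mulr_gt0//.
have -> : 3 * mu * (y / (1 + eps * y ^+ 2)) * (1 + eps * y ^+ 2) ^+ 2 =
  mu * y * (3 * (1 + eps * y ^+ 2)) by field; rewrite gt_eqF.
rewrite ler_pM2l ?mulr_gt0// ler_norml.
have : eps * y <= eps * y ^+ 2 by rewrite ler_pM2l// expr2 ler_peMl// ltW.
have : 0 <= eps * y by rewrite mulr_ge0// ltW.
by move=> h1 h2; apply/andP; split; lra.
Qed.

Lemma psi_le (eps y : R) : 0 < eps -> 1 <= y -> psi eps y <= y.
Proof.
move=> e0 y1; rewrite /psi ler_pdivrMr ?den_gt0// ler_peMr ?lerDl//.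
  exact: le_trans y1.
by rewrite mulr_ge0 ?sqr_ge0// ltW.
Qed.

Lemma psi_ge0 (eps y : R) : 0 < eps -> 1 <= y -> 0 <= psi eps y.
Proof. by move=> e0 y1; have /andP[] := chi_psi e0 y1; exact: le_trans. Qed.

(** The decay at fixed [eps] that makes [||w||] finite. *)
Lemma psi_decay (eps y : R) : 0 < eps -> 1 <= y -> psi eps y <= eps^-1 / y.
Proof.
move=> e0 y1; have y0 : 0 < y by exact: lt_le_trans y1.
rewrite /psi ler_pdivrMr ?den_gt0// -invfM ler_pdivlMl ?mulr_gt0//.
by nra.
Qed.

(** For [y >= 2], [y <= 2 (y - 1)] gives [psi <= 2 chi]. For [y < 2], where [chi] may vanish,
    [psi^2 <= y^2 <= 4 <= 8 / y]. The error is written as [8 / y] because [1 / y = e^(- mu t)] is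
    integrable in time, uniformly in [eps]. *)
Lemma psi_sqr_le (eps y : R) : 0 < eps -> 1 <= y ->
  psi eps y ^+ 2 <= 4 * chi eps y ^+ 2 + 8 / y.
Proof.
move=> e0 y1; have y0 : 0 < y by exact: lt_le_trans y1.
have p0 := psi_ge0 e0 y1; have py := psi_le e0 y1.
have [y2|y2] := leP 2 y.
  have : psi eps y <= 2 * chi eps y.
    rewrite /psi /chi mulrA ler_pM2r ?invr_gt0 ?den_gt0//; lra.
  have : 0 <= 8 / y by rewrite divr_ge0// ltW.
  by move=> h1 h2; nra.
have h : 4 <= 8 / y by rewrite ler_pdivlMr//; lra.
have : 0 <= chi eps y ^+ 2 by exact: sqr_ge0.
have : psi eps y ^+ 2 <= 4 by nra.
by move=> h1 h2; lra.
Qed.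

Lemma chi_ge (eps y : R) : 0 < eps -> 2 <= y -> eps * y ^+ 2 <= 1 ->
  y / 4 <= chi eps y.
Proof.
move=> e0 y2 ey; rewrite /chi ler_pdivlMr ?den_gt0//.
by have : 0 <= eps * y ^+ 2 by [rewrite mulr_ge0 ?sqr_ge0// ltW]; nra.
Qed.

(** Needed to see that the source is not zero. With [eps <= 8^-1] and [y <= 2] one has
    [eps y^2 <= 1/2], so the bracket is at least [1/2] and the squared denominator at most [4]. *)
Lemma dchi_ge (mu eps y : R) : 0 < mu -> 0 < eps -> eps <= 8^-1 ->
  1 <= y <= 2 -> mu / 8 <= dchi mu eps y.
Proof.
move=> mu0 e0 e8 /andP[y1 y2]; rewrite /dchi ler_pdivlMr ?exprn_gt0 ?den_gt0//.
have ey : eps * y ^+ 2 <= 2^-1 by nra.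
have ey0 : 0 <= eps * y ^+ 2 by rewrite mulr_ge0 ?sqr_ge0// ltW.
have ey1 : 0 <= eps * y by rewrite mulr_ge0 ?ltW//; lra.
set d := 1 + _; have d2 : d ^+ 2 <= 4 by rewrite /d; nra.
rewrite -!mulrA ler_pM2l//.
have : 2^-1 <= 1 - eps * y ^+ 2 + 2 * eps * y by lra.
by move=> h; nra.
Qed.

End time_profile.

(** * Space profile *)

Section space_profile.
Context {R : realType}.
Implicit Types (P S : {poly R}) (r : R).

Lemma horner_double_root_bounded P a : P.[a] = 0 -> P^`().[a] = 0 ->
  exists2 C : R, 0 <= C & forall r, 1 <= r <= 2 -> `|P.[r]| <= C * (r - a) ^+ 2.
Proof.
move=> /eqP/factor_theorem[Q PQ]; rewrite PQ derivM derivXsubC mulr1.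
rewrite hornerD hornerM hornerXsubC subrr mulr0 add0r => /horner_root_bounded[C C0 HC].
exists C => // r r12; rewrite hornerM hornerXsubC normrM.
rewrite -(real_normK (num_real (r - a))) expr2 mulrA ler_wpM2r//.
exact: HC.
Qed.

(* With [x = r - 1] this is [(1 - x)^3 * (a * (x + 3 * x^2) + b * x^3)]. *)
Definition bump (a b : R) : {poly R} := let x := 'X - 1%:P in
  a *: x + (b - 6 * a) *: x ^+ 3 + (8 * a - 3 * b) *: x ^+ 4 +
  (3 * b - 3 * a) *: x ^+ 5 + (- b) *: x ^+ 6.

Definition bump' (a b : R) : {poly R} := let x := 'X - 1%:P in
  a%:P + (3 * (b - 6 * a)) *: x ^+ 2 + (4 * (8 * a - 3 * b)) *: x ^+ 3 +
  (5 * (3 * b - 3 * a)) *: x ^+ 4 + (6 * (- b)) *: x ^+ 5.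

Definition bump'' (a b : R) : {poly R} := let x := 'X - 1%:P in
  (6 * (b - 6 * a)) *: x + (12 * (8 * a - 3 * b)) *: x ^+ 2 +
  (20 * (3 * b - 3 * a)) *: x ^+ 3 + (30 * (- b)) *: x ^+ 4.

Lemma deriv_bump a b : (bump a b)^`() = bump' a b.
Proof.
rewrite /bump /bump' !derivD !derivZ !deriv_exp !derivXsubC !mul1r /=.
rewrite -!scalerMnr !scalerMnl alg_polyC.
by congr (_ + _ *: _ + _ *: _ + _ *: _ + _ *: _); ring.
Qed.

Lemma deriv_bump' a b : (bump' a b)^`() = bump'' a b.
Proof.
rewrite /bump' /bump'' !derivD !derivZ !deriv_exp !derivXsubC !mul1r /=.
rewrite derivC add0r -!scalerMnr !scalerMnl expr1.
by congr (_ *: _ + _ *: _ + _ *: _ + _ *: _); rewrite /GRing.scale/=; ring.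
Qed.

Lemma bumpE a b r : (bump a b).[r] = a * (r - 1) + (b - 6 * a) * (r - 1) ^+ 3 +
  (8 * a - 3 * b) * (r - 1) ^+ 4 + (3 * b - 3 * a) * (r - 1) ^+ 5 - b * (r - 1) ^+ 6.
Proof. by rewrite /bump !hornerD !hornerZ !horner_exp !hornerXsubC mulNr. Qed.

Lemma bump'E a b r : (bump' a b).[r] = a + 3 * (b - 6 * a) * (r - 1) ^+ 2 +
  4 * (8 * a - 3 * b) * (r - 1) ^+ 3 + 5 * (3 * b - 3 * a) * (r - 1) ^+ 4 -
  6 * b * (r - 1) ^+ 5.
Proof. by rewrite /bump' !hornerD !hornerZ !horner_exp !hornerXsubC hornerC mulrN mulNr. Qed.

Lemma bump''E a b r : (bump'' a b).[r] = 6 * (b - 6 * a) * (r - 1) +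
  12 * (8 * a - 3 * b) * (r - 1) ^+ 2 + 20 * (3 * b - 3 * a) * (r - 1) ^+ 3 -
  30 * b * (r - 1) ^+ 4.
Proof. by rewrite /bump'' !hornerD !hornerZ !horner_exp !hornerXsubC mulrN mulNr. Qed.

Lemma deriv_bump''1 a b : (bump'' a b)^`().[1] = 6 * (b - 6 * a).
Proof.
rewrite /bump'' !derivD !derivZ !deriv_exp !derivXsubC !mul1r /=.
rewrite !hornerD !hornerZ !hornerMn hornerC !horner_exp !hornerXsubC subrr.
by ring.
Qed.

Lemma admissible_bump a b : admissible (bump a b).
Proof.
split; rewrite ?deriv_bump ?deriv_bump' ?bumpE ?bump'E ?bump''E; ring.
Qed.

(** The error of freezing [1 / r^2] at [r = 1]; against a profile with a root at [1] it is of second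
    order. *)
Lemma inv_sqr_sub1_bound r : 1 <= r -> `|r ^- 2 - 1| <= 2 * (r - 1).
Proof.
move=> r1; have r0 : 0 < r by exact: lt_le_trans r1.
have -> : r ^- 2 - 1 = - ((r - 1) * (r + 1)) / r ^+ 2.
  by field; rewrite gt_eqF.
rewrite normrM normrN normfV ger0_norm; last by rewrite mulr_ge0; lra.
rewrite (ger0_norm (sqr_ge0 r)) ler_pdivrMr ?exprn_gt0// -subr_ge0.
have -> : 2 * (r - 1) * r ^+ 2 - (r - 1) * (r + 1) = (r - 1) ^+ 2 * (2 * r + 1) by ring.
by rewrite mulr_ge0 ?sqr_ge0//; lra.
Qed.

Section quasimode.
Variables (k : int) (nu B lam : R).
Hypothesis nu0 : 0 < nu.

Let c0 : R := k%:~R ^+ 2 - 4^-1.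
Let c1 : R := k%:~R * B.
(* The coefficients of [x^3] are chosen so that the linear part of
   [(T - lam) (P + i S)] at [r = 1] vanishes. *)
Let P := bump 1 (6 + (nu * c0 - lam) / (6 * nu)).
Let S := bump 0 (c1 / (6 * nu)).

(** With the potential frozen at [r = 1] the residual is a polynomial with a double root at [1]; the
    correction is a product of two first-order factors. The real part is the case [(P, S, - c1)] and
    the imaginary part the case [(S, P, c1)]. *)
Lemma quasimode_residual_aux (P1 P2 : {poly R}) (d0 d1 : R) :
  P1.[1] = 0 -> P2.[1] = 0 ->
  (- nu *: P1^`()^`() + (d0 - lam) *: P1 + d1 *: P2).[1] = 0 ->
  (- nu *: P1^`()^`() + (d0 - lam) *: P1 + d1 *: P2)^`().[1] = 0 ->
  exists2 C : R, 0 <= C & forall r, 1 < r < 2 ->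
  `|- nu * P1^`()^`().[r] + d0 / r ^+ 2 * P1.[r] + d1 / r ^+ 2 * P2.[r]
    - lam * P1.[r]| <= C * (r - 1) ^+ 2.
Proof.
move=> P11 P21 Q1 Q'1.
have [C1 C10 HC1] := horner_double_root_bounded Q1 Q'1.
have R1 : (d0 *: P1 + d1 *: P2).[1] = 0 by rewrite hornerD !hornerZ P11 P21 !mulr0 addr0.
have [C2 C20 HC2] := horner_root_bounded R1.
exists (C1 + 2 * C2); first by rewrite addr_ge0// mulr_ge0.
move=> r /andP[r1 r2]; have r12 : 1 <= r <= 2 by rewrite !ltW.
have -> : - nu * P1^`()^`().[r] + d0 / r ^+ 2 * P1.[r] + d1 / r ^+ 2 * P2.[r] - lam * P1.[r] =
  (- nu *: P1^`()^`() + (d0 - lam) *: P1 + d1 *: P2).[r] +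
  (r ^- 2 - 1) * (d0 *: P1 + d1 *: P2).[r].
  by rewrite !hornerD !hornerZ; ring.
rewrite (le_trans (ler_normD _ _))// [leRHS]mulrDl; apply: lerD; first exact: HC1.
rewrite normrM.
have x0 : 0 <= r - 1 by rewrite subr_ge0 ltW.
have := HC2 r r12; rewrite (ger0_norm x0) => h2.
have h1 := inv_sqr_sub1_bound (ltW r1).
have -> : 2 * C2 * (r - 1) ^+ 2 = (2 * (r - 1)) * (C2 * (r - 1)) by ring.
by rewrite ler_pM.
Qed.

Lemma space_profile : exists P S C x1, [/\ admissible P, admissible S,
  0 < C, 0 < x1 < 1 &
  [/\ forall r, 1 < r < 2 -> `|P.[r]| <= C * (r - 1) /\ `|S.[r]| <= C * (r - 1),
      forall r, 1 < r < 2 ->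
        `|opT_re k nu B P S r - lam * P.[r]| <= C * (r - 1) ^+ 2 /\
        `|opT_im k nu B P S r - lam * S.[r]| <= C * (r - 1) ^+ 2 &
      forall r, 1 < r <= 1 + x1 -> (r - 1) / 2 <= P.[r]]].
Proof.
have nuN0 : nu != 0 by rewrite gt_eqF.
have [P1 _ _ _] : admissible P by exact: admissible_bump.
have [S1 _ _ _] : admissible S by exact: admissible_bump.
have P' : P^`() = bump' 1 (6 + (nu * c0 - lam) / (6 * nu)) by exact: deriv_bump.
have P'' : P^`()^`() = bump'' 1 (6 + (nu * c0 - lam) / (6 * nu)).
  by rewrite P' deriv_bump'.
have S' : S^`() = bump' 0 (c1 / (6 * nu)) by exact: deriv_bump.
have S'' : S^`()^`() = bump'' 0 (c1 / (6 * nu)) by rewrite S' deriv_bump'.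
have [CP CP0 HCP] := horner_root_bounded P1.
have [CS CS0 HCS] := horner_root_bounded S1.
have [||C1 C10 HC1] := @quasimode_residual_aux P S (nu * c0) (- c1) P1 S1.
- by rewrite !hornerD !hornerZ P1 S1 P'' bump''E !subrr; ring.
(* The cubic coefficient of [bump a b] is [b - 6 * a], whence the summand [6] in [P]. At [1] the
   slopes of [P] and [S] are [1] and [0], so the condition reads [- nu * 6 * ((nu * c0 - lam) / (6 *
   nu)) + (nu * c0 - lam) = 0]. *)
- rewrite P'' !derivD !derivZ !hornerD !hornerZ P' S' deriv_bump''1 !bump'E.
  by field.
have [||C2 C20 HC2] := @quasimode_residual_aux S P (nu * c0) c1 S1 P1.
- by rewrite !hornerD !hornerZ P1 S1 S'' bump''E !subrr; ring.
- rewrite S'' !derivD !derivZ !hornerD !hornerZ P' S' deriv_bump''1 !bump'E.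
  by field.
have [||C3 C30 HC3] := @horner_double_root_bounded (P - ('X - 1%:P)) 1.
- by rewrite hornerD hornerN P1 hornerXsubC subrr subr0.
- rewrite derivD derivN derivXsubC hornerD hornerN hornerC P' bump'E subrr.
  by ring.
pose C := 1 + CP + CS + C1 + C2.
have C0 : 0 < C by rewrite /C; lra.
(* For [r - 1] below this value the remainder [C3 * (r - 1) ^+ 2] is at most half of [r - 1]; the
   summand [1] keeps it below one even if [C3 = 0]. *)
exists P, S, C, (2 * (1 + C3))^-1; split => //.
- exact: admissible_bump.
- exact: admissible_bump.
- rewrite invr_gt0 mulr_gt0//=; last by lra.
  by rewrite invf_lt1; lra.
split.
- move=> r /andP[r1 r2]; have r12 : 1 <= r <= 2 by rewrite !ltW.
  have x0 : 0 <= r - 1 by rewrite subr_ge0 ltW.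
  have := HCP r r12; have := HCS r r12; rewrite (ger0_norm x0) => hS hP.
  by split; [apply: (le_trans hP)|apply: (le_trans hS)]; rewrite ler_wpM2r// /C; lra.
- move=> r r12; have x0 : 0 <= (r - 1) ^+ 2 by exact: sqr_ge0.
  have /andP[_ r2] := r12.
  have h1 := HC1 r r12; have h2 := HC2 r r12.
  split.
    apply: (@le_trans _ _ (C1 * (r - 1) ^+ 2)); last by rewrite ler_wpM2r// /C; lra.
    apply: le_trans h1; rewrite /opT_re /cut r2 -/c0 -/c1.
    by rewrite le_eqVlt; apply/orP; left; apply/eqP; congr `|_|; ring.
  apply: (@le_trans _ _ (C2 * (r - 1) ^+ 2)); last by rewrite ler_wpM2r// /C; lra.
  apply: le_trans h2; rewrite /opT_im /cut r2 -/c0 -/c1.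
  by rewrite le_eqVlt; apply/orP; left; apply/eqP; congr `|_|; ring.
- move=> r /andP[r1 rx].
  have hx : r - 1 <= (2 * (1 + C3))^-1 by lra.
  have hx1 : (2 * (1 + C3))^-1 <= 1 by rewrite invf_le1; lra.
  have x0 : 0 < r - 1 by rewrite subr_gt0.
  have := HC3 r; rewrite hornerD hornerN hornerXsubC => /(_ _) h.
  have {}h : `|P.[r] - (r - 1)| <= C3 * (r - 1) ^+ 2.
    by apply: h; apply/andP; split; lra.
  have h2 : C3 * (r - 1) ^+ 2 <= (r - 1) / 2.
    have : (r - 1) * (2 * (1 + C3)) <= 1 by rewrite -ler_pdivlMr ?mul1r//; lra.
    by move=> h3; nra.
  by have := le_trans h h2; rewrite ler_norml => /andP[h3 _]; lra.
Qed.

End quasimode.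
End space_profile.

(** * Concentration at the boundary *)

Section weights.
Context {R : realType}.
Implicit Types (a phi : R -> R).

Lemma weight_bounds a : {within `[1, +oo[, continuous a} ->
  (forall r, 1 <= r -> 0 < a r) ->
  exists m M : R, 0 < m /\ forall r, 1 <= r <= 2 -> m <= a r <= M.
Proof.
move=> ca a0.
have ca12 : {within `[1, 2], continuous a}.
  apply: continuous_subspaceW ca => r /=; rewrite !in_itv/= andbT.
  by move=> /andP[].
have le12 : (1 : R) <= 2 by rewrite ler1n.
have [c1 c1I h1] := EVT_max le12 ca12; have [c2 c2I h2] := EVT_min le12 ca12.
exists (a c2), (a c1); split.
  by apply: a0; move: c2I; rewrite in_itv/= => /andP[].
by move=> r r12; rewrite h1 ?h2.
Qed.

Lemma measurable_weight a : {within `[1, +oo[, continuous a} ->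
  measurable_fun Omega a.
Proof.
move=> /continuous_within_itvcyP[/in_continuous_mksetP ca _].
by apply: open_continuous_measurable_fun => //; exact: interval_open.
Qed.

Lemma measurable_decreasing phi :
  (forall r s, 1 <= r -> r < s -> phi s < phi r) -> measurable_fun Omega phi.
Proof.
move=> phi_decr.
(* Monotonicity is known only on [[1, +oo[]; composing with [Num.max 1] extends it to the whole
   line. *)
have : measurable_fun (@Omega R) (fun r => phi (Num.max 1 r)).
  apply: nonincreasing_measurable; first exact: measurable_Omega.
  move=> r s rs; have [->//|/eqP ne] := eqVneq (Num.max 1 r) (Num.max 1 s).
  apply: ltW; apply: phi_decr; first by rewrite le_max lexx.
  rewrite lt_neqAle; apply/andP; split; first exact/eqP.
  by rewrite ge_max !le_max lexx rs orbT.
apply: eq_measurable_fun => r /set_mem; rewrite /Omega/= in_itv/= andbT => r1.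
by rewrite (max_idPr _)// ltW.
Qed.

Definition weighted phi a (W : R -> R -> R[i]) (t r : R) : R[i] :=
  ((expR (t * phi r) * a r)%:C * W t r)%C.

Lemma cmeasurable_weighted phi a W : measurable_fun Omega phi ->
  measurable_fun Omega a ->
  cmeasurable (Time `*` Omega) (fun z : R * R => W z.1 z.2) ->
  cmeasurable (Time `*` Omega) (fun z : R * R => weighted phi a W z.1 z.2).
Proof.
move=> mphi ma [mre mim].
have mw : measurable_fun (Time `*` Omega)
    (fun z : R * R => expR (z.1 * phi z.2) * a z.2).
  apply: measurable_funM; last exact: measurable_snd_comp.
  apply: measurableT_comp; first exact: measurable_expR.
  apply: measurable_funM; last exact: measurable_snd_comp.
  by apply: (@measurable_fst_comp _ id) => t; exact: cvg_id.
split.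
  apply: (eq_measurable_fun (fun z : R * R => expR (z.1 * phi z.2) * a z.2 * complex.Re (W z.1 z.2))).
    by move=> z _; rewrite /weighted; case: (W z.1 z.2) => x y /=; rewrite mul0r subr0.
  exact: measurable_funM.
apply: (eq_measurable_fun (fun z : R * R => expR (z.1 * phi z.2) * a z.2 * complex.Im (W z.1 z.2))).
  by move=> z _; rewrite /weighted; case: (W z.1 z.2) => x y /=; rewrite mul0r addr0.
exact: measurable_funM.
Qed.

(** The number [lam] is the right limit of [phi] at [1], which may be smaller than [phi 1] since
    [phi] can jump. Strict decrease keeps it unattained: the midpoint of [1] and [r] has a larger
    value than [r]. *)
Lemma sup_decreasing phi : (forall r s, 1 <= r -> r < s -> phi s < phi r) ->
  exists lam, (forall r, 1 < r -> phi r < lam) /\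
    forall d, 0 < d -> exists2 r', 1 < r' &
      forall r, 1 < r <= r' -> lam - d < phi r.
Proof.
move=> phi_decr; pose E := [set phi r | r in (@Omega R)].
have E1 r : 1 < r -> E (phi r).
  by move=> r1; exists r => //; rewrite /Omega/= in_itv/= r1.
have uE : has_ubound E.
  exists (phi 1) => _ [r + <-]; rewrite /Omega/= in_itv/= andbT => r1.
  by rewrite ltW// phi_decr.
have sE : has_sup E by split=> //; exists (phi 2); apply: E1; rewrite ltr1n.
exists (sup E); split=> [r r1|d d0].
  apply: (@lt_le_trans _ _ (phi ((1 + r) / 2))).
    by apply: phi_decr; lra.
  by apply: ub_le_sup => //; apply: E1; lra.
have [_ [r' + <-] h] := sup_adherent d0 sE.
rewrite /Omega/= in_itv/= andbT => r'1; exists r' => // r /andP[r1].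
rewrite le_eqVlt => /predU1P[->//|rr'].
by apply: (lt_trans h); apply: phi_decr => //; exact: ltW.
Qed.

End weights.

(** * Weighted estimates for the solution and its source, and the choice of the parameters *)

Section concentration.
Context {R : realType}.
Local Notation leb := (@lebesgue_measure R).
Variables (k : int) (nu B : R) (a1 a2 phi : R -> R).
Variables (lam m M C x1 : R) (P S : {poly R}).
Hypotheses (a1_meas : measurable_fun Omega a1) (a2_meas : measurable_fun Omega a2)
  (phi_meas : measurable_fun Omega phi).
Hypothesis phi_decr : forall r s, 1 <= r -> r < s -> phi s < phi r.
Hypothesis phi_lt : forall r, 1 < r -> phi r < lam.
Hypothesis phi_lam : forall d, 0 < d ->
  exists2 r', 1 < r' & forall r, 1 < r <= r' -> lam - d < phi r.
Hypotheses (m0 : 0 < m) (M0 : 0 < M)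
  (a1_bnd : forall r, 1 <= r <= 2 -> m <= a1 r <= M)
  (a2_bnd : forall r, 1 <= r <= 2 -> m <= a2 r <= M).
Hypotheses (aP : admissible P) (aS : admissible S) (C0 : 0 < C)
  (x10 : 0 < x1) (x11 : x1 < 1).
Hypothesis PS_bnd : forall r, 1 < r < 2 ->
  `|P.[r]| <= C * (r - 1) /\ `|S.[r]| <= C * (r - 1).
Hypothesis res_bnd : forall r, 1 < r < 2 ->
  `|opT_re k nu B P S r - lam * P.[r]| <= C * (r - 1) ^+ 2 /\
  `|opT_im k nu B P S r - lam * S.[r]| <= C * (r - 1) ^+ 2.
Hypothesis P_low : forall r, 1 < r <= 1 + x1 -> (r - 1) / 2 <= P.[r].

Definition Xt (mu eps t : R) := chi eps (expR (mu * t)) * expR (- lam * t).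
Definition Yt (mu eps t : R) :=
  (dchi mu eps (expR (mu * t)) - lam * chi eps (expR (mu * t))) * expR (- lam * t).

Definition wsol mu eps := sep_w (Xt mu eps) P S.
Definition fsol mu eps := sep_f k nu B (Xt mu eps) (Yt mu eps) P S.

Lemma strong_solution_sol mu eps : 0 < eps ->
  strong_solution k nu B (wsol mu eps) (fsol mu eps).
Proof.
move=> e0.
have dchit t := is_derive_chi mu t e0.
have cchi : continuous (fun t => chi eps (expR (mu * t))).
  by move=> t; apply/differentiable_continuous/derivable1_diffP; have [] := dchit t.
apply: strong_solution_separated => //.
- move=> t; have dE := is_derive_expRM (- lam) t.
  apply: (is_derive_eq (is_deriveM (dchit t) dE)).
  by rewrite /GRing.scale/= /Yt; ring.
- move=> t; apply: cvgM; last exact: continuous_expRM.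
  apply: cvgB; first exact: continuous_dchi.
  by apply: cvgMr; exact: cchi.
- by rewrite /Xt mulr0 expR0 /chi subrr mul0r mul0r.
Qed.

Lemma cmeas_w mu eps : 0 < eps ->
  cmeasurable (Time `*` Omega) (fun z : R * R => weighted phi a1 (wsol mu eps) z.1 z.2).
Proof.
move=> e0; apply: cmeasurable_weighted => //.
by have [_ _ _ [w1 [w2 [wt [[[mw _] _ _ _] _ _ _]]]]] := strong_solution_sol mu e0.
Qed.

Lemma cmeas_f mu eps : 0 < eps ->
  cmeasurable (Time `*` Omega) (fun z : R * R => weighted phi a2 (fsol mu eps) z.1 z.2).
Proof.
move=> e0; apply: cmeasurable_weighted => //.
by have [[mf _] _ _ _] := strong_solution_sol mu e0.
Qed.

Lemma sqnormc_w mu eps t r : r < 2 ->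
  sqnormc (weighted phi a1 (wsol mu eps) t r) =
  (a1 r * expR (t * (phi r - lam)) * chi eps (expR (mu * t))) ^+ 2 *
  (P.[r] ^+ 2 + S.[r] ^+ 2).
Proof.
move=> r2; rewrite /weighted /wsol /sep_w !sqnormcZ /sqnormc /profile/= /cut r2 /Xt.
have -> : expR (t * (phi r - lam)) = expR (t * phi r) * expR (- lam * t).
  by rewrite -expRD; congr expR; ring.
by ring.
Qed.

Lemma sqnormc_w_out mu eps t r : 2 <= r ->
  sqnormc (weighted phi a1 (wsol mu eps) t r) = 0.
Proof.
move=> r2; rewrite /weighted /wsol /sep_w !sqnormcZ /sqnormc /profile/= /cut.
by rewrite ltNge r2/= expr0n addr0 !mulr0.
Qed.

(** The term [- lam * chi] of [Yt] joins [T g] to form [(T - lam) g], leaving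
    [chi' g + chi (T - lam) g]. *)
Lemma sqnormc_f mu eps t r : r < 2 ->
  sqnormc (weighted phi a2 (fsol mu eps) t r) =
  (a2 r * expR (t * (phi r - lam))) ^+ 2 *
  ((dchi mu eps (expR (mu * t)) * P.[r] +
    chi eps (expR (mu * t)) * (opT_re k nu B P S r - lam * P.[r])) ^+ 2 +
   (dchi mu eps (expR (mu * t)) * S.[r] +
    chi eps (expR (mu * t)) * (opT_im k nu B P S r - lam * S.[r])) ^+ 2).
Proof.
move=> r2; rewrite /weighted sqnormcZ /sqnormc /fsol /sep_f /separated /=.
have cE Q : cut Q r = Q.[r] by rewrite /cut r2.
rewrite !cE /Xt /Yt.
have -> : expR (t * (phi r - lam)) = expR (t * phi r) * expR (- lam * t).
  by rewrite -expRD; congr expR; ring.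
by ring.
Qed.

Lemma sqnormc_f_out mu eps t r : 2 <= r ->
  sqnormc (weighted phi a2 (fsol mu eps) t r) = 0.
Proof.
move=> r2; rewrite /weighted sqnormcZ /sqnormc /fsol /sep_f /separated /=.
rewrite /opT_re /opT_im; have cE Q : cut Q r = 0 by rewrite /cut ltNge r2.
by rewrite !cE; ring.
Qed.

(** Here [chi' g] has size [3 mu psi C x] and [chi (T - lam) g] has size [psi C x^2]; relative to
    [g], of size [x], the gain is the factor [3 mu + x]. *)
Lemma sqr_norm_sum (d c p A mu' ps x : R) : `|d| <= 3 * mu' * ps -> 0 <= c <= ps ->
  `|p| <= C * x -> `|A| <= C * x ^+ 2 -> 0 <= x -> 0 <= mu' ->
  (d * p + c * A) ^+ 2 <= (C * ps * x * (3 * mu' + x)) ^+ 2.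
Proof.
move=> hd /andP[c0 cps] hp hA x0 mu0; apply: sqr_le_norm.
have ps0 := le_trans c0 cps.
rewrite (le_trans (ler_normD _ _))// !normrM (ger0_norm c0).
have -> : C * ps * x * (3 * mu' + x) = 3 * mu' * ps * (C * x) + ps * (C * x ^+ 2) by ring.
by rewrite lerD// ler_pM.
Qed.

Lemma expR_ge1t (mu t : R) : 0 < mu -> 0 < t -> 1 <= expR (mu * t).
Proof. by move=> mu0 t0; rewrite -expR0 ler_expR mulr_ge0// ltW. Qed.

(** For [x <= x0] the gain [3 mu + x] is at most [4 x0], and [psi] is exchanged for [chi] through
    [psi_sqr_le]. For [x > x0] the decay of the weight outweighs the growth of [psi]. The errors of
    both regions decay like [e^(- mu t)] and are independent of [eps]. *)
Lemma pointwise_domination (mu eps x0 : R) : 0 < mu -> 0 < eps ->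
  0 < x0 <= x1 -> mu <= x0 -> 3 * mu <= 2 * (lam - phi (1 + x0)) ->
  forall t r, Time t -> Omega r ->
  sqnormc (weighted phi a2 (fsol mu eps) t r) <=
  512 * C ^+ 2 * M ^+ 2 * x0 ^+ 2 / m ^+ 2 *
    sqnormc (weighted phi a1 (wsol mu eps) t r) +
  (if r < 2 then 256 * M ^+ 2 * C ^+ 2 * expR (- mu * t) else 0).
Proof.
move=> mu0 e0 /andP[x00 x0x1] mux0 mud t r.
(* Kept abstract: unification unfolds large numerals into iterated sums. *)
have [K1 K1E] : exists K : R, K = 512 by exists 512.
have [K2 K2E] : exists K : R, K = 256 by exists 256.
have K10 : 0 <= K1 by rewrite K1E ler0n.
have K20 : 0 <= K2 by rewrite K2E ler0n.
rewrite -K1E -K2E.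
rewrite /Time /Omega/= !in_itv/= !andbT => t0 r1.
case: ltP => r2; last by rewrite sqnormc_f_out// sqnormc_w_out// mulr0 addr0.
rewrite sqnormc_f// sqnormc_w//.
have y1 := expR_ge1t mu0 t0.
set y := expR (mu * t) in y1 *.
have yV : expR (- mu * t) = y^-1 by rewrite mulNr expRN.
have r12 : 1 < r < 2 by rewrite r1.
have [hP hS] := PS_bnd r12.
have [hA hD] := res_bnd r12.
have /andP[m2 M2] : m <= a2 r <= M by apply: a2_bnd; rewrite !ltW.
have /andP[m1 M1] : m <= a1 r <= M by apply: a1_bnd; rewrite !ltW.
have x0' : 0 <= r - 1 by rewrite subr_ge0 ltW.
have hd := dchi_bound mu0 e0 y1.
have hc := chi_psi e0 y1.
have hps := psi_sqr_le e0 y1.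
have psy := psi_le e0 y1.
have ps0 := psi_ge0 e0 y1.
have b1 := sqr_norm_sum hd hc hP hA x0' (ltW mu0).
have b2 := sqr_norm_sum hd hc hS hD x0' (ltW mu0).
have b := lerD b1 b2.
set br := (X in X <= _) in b; rewrite -/br.
have br0 : 0 <= br by rewrite addr_ge0 ?sqr_ge0.
clearbody br; move=> {b1 b2 hA hD hd}.
set x := r - 1 in b hP hS x0' *.
set e := expR (t * (phi r - lam)).
set ch := chi eps y in hc hps *; set ps := psi eps y in b hc hps psy ps0 *.
clearbody ch ps.
have e_gt0 : 0 < e by exact: expR_gt0.
have e_le1 : e <= 1.
  by rewrite -expR0 ler_expR mulr_ge0_le0 ?ltW// subr_lt0 phi_lt.
rewrite yV.
have y0 : 0 < y by exact: lt_le_trans y1.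
have yV0 : 0 < y^-1 by rewrite invr_gt0.
have a2e : (a2 r * e) ^+ 2 <= M ^+ 2 * e ^+ 2.
  have a20 : 0 <= a2 r by exact: le_trans (ltW m0) m2.
  rewrite exprMn; apply: ler_wpM2r; first exact: sqr_ge0.
  by rewrite ler_sqr// nnegrE ltW.
have x_lt1 : x < 1 by rewrite /x; lra.
apply: (le_trans (ler_wpM2r br0 a2e)).
have [xx0|xx0] := leP x x0.
  (* Two components and [3 * mu + x <= 4 * x0] give [32 = 2 * 4 ^+ 2]. *)
  have hb : br <= 32 * C ^+ 2 * x0 ^+ 2 * (ps ^+ 2 * x ^+ 2).
    apply: (le_trans b).
    have -> : (C * ps * x * (3 * mu + x)) ^+ 2 + (C * ps * x * (3 * mu + x)) ^+ 2 =
      2 * C ^+ 2 * (ps ^+ 2 * x ^+ 2) * (3 * mu + x) ^+ 2 by ring.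
    have -> : 32 * C ^+ 2 * x0 ^+ 2 * (ps ^+ 2 * x ^+ 2) =
      2 * C ^+ 2 * (ps ^+ 2 * x ^+ 2) * (4 * x0) ^+ 2 by ring.
    apply: ler_wpM2l; first by rewrite !(sqr_ge0, mulr_ge0).
    by rewrite ler_sqr ?nnegrE; lra.
  have hw : x ^+ 2 / 4 <= P.[r] ^+ 2 + S.[r] ^+ 2.
    have : x / 2 <= P.[r] by apply: P_low; rewrite r1/=; move: xx0; rewrite /x; lra.
    by have := sqr_ge0 S.[r]; nra.
  have a1m : m ^+ 2 <= a1 r ^+ 2.
    by rewrite ler_sqr ?nnegrE ?(ltW m0)// (le_trans (ltW m0)).
  (* [128 = 32 * 4] with the [4] of [psi_sqr_le]; the lower bound [x ^+ 2 / 4] for the squared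
     profile costs another [4], hence [512]. *)
  have first_term : 128 * C ^+ 2 * M ^+ 2 * x0 ^+ 2 * (e ^+ 2 * ch ^+ 2 * x ^+ 2) <=
      K1 * C ^+ 2 * M ^+ 2 * x0 ^+ 2 / m ^+ 2 *
      ((a1 r * e * ch) ^+ 2 * (P.[r] ^+ 2 + S.[r] ^+ 2)).
    have -> : 128 * C ^+ 2 * M ^+ 2 * x0 ^+ 2 * (e ^+ 2 * ch ^+ 2 * x ^+ 2) =
        K1 * C ^+ 2 * M ^+ 2 * x0 ^+ 2 / m ^+ 2 *
        ((m * e * ch) ^+ 2 * (x ^+ 2 / 4)) by rewrite K1E; field; rewrite gt_eqF.
    apply: ler_wpM2l.
      by rewrite mulr_ge0 ?invr_ge0 ?sqr_ge0// !(sqr_ge0, mulr_ge0).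
    apply: ler_pM; [exact: sqr_ge0| | |exact: hw].
      by rewrite mulr_ge0 ?sqr_ge0// invr_ge0.
    have sqE z : (z * e * ch) ^+ 2 = z ^+ 2 * (e * ch) ^+ 2 by ring.
    by rewrite !sqE; apply: ler_wpM2r => //; exact: sqr_ge0.
  (* [256 = 32 * 8] with the [8 / y] of [psi_sqr_le]; [x0], [e] and [x] are at most one. *)
  have second_term : K2 * C ^+ 2 * M ^+ 2 * x0 ^+ 2 * (e ^+ 2 * x ^+ 2) / y <=
      K2 * M ^+ 2 * C ^+ 2 / y.
    rewrite ler_pM2r//.
    have -> : K2 * C ^+ 2 * M ^+ 2 * x0 ^+ 2 * (e ^+ 2 * x ^+ 2) =
      K2 * M ^+ 2 * C ^+ 2 * ((x0 * e * x) ^+ 2) by ring.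
    apply: ler_piMr; first by rewrite !(sqr_ge0, mulr_ge0).
    have x0e : 0 <= x0 * e by rewrite mulr_ge0 ?ltW.
    apply: exprn_ile1; first by rewrite mulr_ge0.
    apply: mulr_ile1 => //; last exact: ltW.
    by apply: mulr_ile1 => //; [exact: ltW|exact: ltW|exact: le_trans x0x1 (ltW x11)].
  apply: (@le_trans _ _ (128 * C ^+ 2 * M ^+ 2 * x0 ^+ 2 * (e ^+ 2 * ch ^+ 2 * x ^+ 2) +
    K2 * C ^+ 2 * M ^+ 2 * x0 ^+ 2 * (e ^+ 2 * x ^+ 2) / y)); last exact: lerD.
  have -> : 128 * C ^+ 2 * M ^+ 2 * x0 ^+ 2 * (e ^+ 2 * ch ^+ 2 * x ^+ 2) +
    K2 * C ^+ 2 * M ^+ 2 * x0 ^+ 2 * (e ^+ 2 * x ^+ 2) / y =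
    M ^+ 2 * e ^+ 2 * (32 * C ^+ 2 * x0 ^+ 2 * ((4 * ch ^+ 2 + 8 / y) * x ^+ 2)) by rewrite K2E; ring.
  apply: ler_wpM2l; first by rewrite mulr_ge0 ?sqr_ge0.
  apply: (le_trans hb); apply: ler_wpM2l; first by rewrite !(sqr_ge0, mulr_ge0).
  by rewrite ler_wpM2r ?sqr_ge0.
have hb : br <= 32 * C ^+ 2 * y ^+ 2.
  apply: (le_trans b).
  have -> : (C * ps * x * (3 * mu + x)) ^+ 2 + (C * ps * x * (3 * mu + x)) ^+ 2 =
      2 * C ^+ 2 * ((ps * x * (3 * mu + x)) ^+ 2) by ring.
  have -> : 32 * C ^+ 2 * y ^+ 2 = 2 * C ^+ 2 * ((y * 1 * 4) ^+ 2) by ring.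
  apply: ler_wpM2l; first by rewrite mulr_ge0 ?sqr_ge0.
  have h0 : 0 <= 3 * mu + x by rewrite addr_ge0// mulr_ge0// ltW.
  rewrite ler_sqr ?nnegrE; last 2 first.
  - by rewrite !mulr_ge0.
  - by rewrite !mulr_ge0// ltW.
  apply: ler_pM => //; first by rewrite mulr_ge0.
    by apply: ler_pM => //; exact: ltW.
  by lra.
(* Three powers of [y] are to be absorbed: two from [psi ^+ 2] and one to leave the integrable
   [y^-1]. This is the origin of [3 * mu <= 2 * (lam - phi (1 + x0))]. *)
have ey : e ^+ 2 * y ^+ 2 <= y^-1.
  rewrite -[leRHS]mul1r ler_pdivlMr//.
  have -> : e ^+ 2 * y ^+ 2 * y = expR (t * (3 * mu - 2 * (lam - phi r))).
    by rewrite /e /y -!expRM_natl -!expRD; congr expR; ring.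
  rewrite -[leRHS]expR0 ler_expR.
  have pr : phi r < phi (1 + x0).
    by apply: phi_decr; [lra|move: xx0; rewrite /x; lra].
  apply: mulr_ge0_le0; first exact: ltW.
  rewrite subr_le0; apply: (le_trans mud).
  by rewrite ler_pM2l// lerD2l lerN2 ltW.
rewrite -[leLHS]add0r; apply: lerD.
  rewrite mulr_ge0//; last by rewrite mulr_ge0 ?sqr_ge0// addr_ge0 ?sqr_ge0.
  by rewrite mulr_ge0 ?invr_ge0 ?sqr_ge0// !(sqr_ge0, mulr_ge0).
apply: (@le_trans _ _ (32 * M ^+ 2 * C ^+ 2 * y^-1)); last first.
  apply: ler_wpM2r; first exact: ltW.
  by do 2![apply: ler_wpM2r; first exact: sqr_ge0]; rewrite K2E ler_nat.
apply: (@le_trans _ _ (M ^+ 2 * e ^+ 2 * (32 * C ^+ 2 * y ^+ 2))).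
  by apply: ler_wpM2l => //; rewrite mulr_ge0 ?sqr_ge0.
have -> : M ^+ 2 * e ^+ 2 * (32 * C ^+ 2 * y ^+ 2) =
  32 * M ^+ 2 * C ^+ 2 * (e ^+ 2 * y ^+ 2) by ring.
by apply: ler_wpM2l => //; rewrite !(sqr_ge0, mulr_ge0).
Qed.

Definition sqint (W : R -> R -> R[i]) : \bar R :=
  (\int[leb]_(t in Time) \int[leb]_(r in Omega) (sqnormc (W t r))%:E)%E.

Lemma sqint_w_lty mu eps : 0 < mu -> 0 < eps ->
  (sqint (weighted phi a1 (wsol mu eps)) < +oo)%E.
Proof.
move=> mu0 e0; pose Hc : R := (M * eps^-1) ^+ 2 * (2 * C ^+ 2).
have Hc0 : 0 <= Hc by rewrite mulr_ge0 ?sqr_ge0// mulr_ge0 ?sqr_ge0.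
have cE : measurable_fun Time (fun t : R => Hc * expR (- mu * t)).
  apply: (measurable_funS measurableT) => //; apply: continuous_measurable_fun => t.
  by apply: cvgMr; exact: continuous_expRM.
apply: le_lt_trans (sqint_le (W := fun _ _ => 0%C) (kap := 0)
  measurable_Time (@subset_refl _ _) _ (cmeas_w mu e0) cE _ _ _) _ => //.
- by move=> t _; rewrite mulr_ge0 ?expR_ge0.
- move=> t r; rewrite /Time /Omega/= !in_itv/= !andbT => t0 r1.
  rewrite mul0r add0r; case: ltP => r2; last by rewrite sqnormc_w_out.
  rewrite sqnormc_w//; have y1 := expR_ge1t mu0 t0.
  rewrite mulNr expRN; set y := expR (mu * t) in y1 *.
  have y0 : 0 < y by exact: lt_le_trans y1.
  have r12 : 1 < r < 2 by rewrite r1.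
  have [hP hS] := PS_bnd r12.
  have x1' : r - 1 <= 1 by rewrite lerBlDr ltW.
  have Cx : C * (r - 1) <= C by rewrite ler_piMr// ltW.
  have PS : P.[r] ^+ 2 + S.[r] ^+ 2 <= 2 * C ^+ 2.
    rewrite mulr_natl mulr2n; apply: lerD; apply: sqr_le_norm; exact: le_trans Cx.
  have /andP[m1 M1] : m <= a1 r <= M by apply: a1_bnd; rewrite !ltW.
  have a10 : 0 <= a1 r by exact: le_trans (ltW m0) m1.
  set e := expR (t * (phi r - lam)).
  have e_ge0 : 0 <= e by exact: expR_ge0.
  have e_le1 : e <= 1.
    by rewrite -expR0 ler_expR mulr_ge0_le0 ?ltW// subr_lt0 phi_lt.
  have /andP[c0 cp] := chi_psi e0 y1; have pd := psi_decay e0 y1.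
  have big : a1 r * e * chi eps y <= M * 1 * (eps^-1 / y).
    apply: ler_pM => //; first by rewrite mulr_ge0.
      exact: ler_pM.
    exact: le_trans pd.
  apply: (@le_trans _ _ ((M * 1 * (eps^-1 / y)) ^+ 2 * (2 * C ^+ 2))).
    apply: ler_pM => //; first exact: sqr_ge0.
      by rewrite addr_ge0 ?sqr_ge0.
    have big0 : 0 <= a1 r * e * chi eps y.
      by apply: mulr_ge0 => //; exact: mulr_ge0.
    by rewrite ler_sqr// nnegrE (le_trans big0).
  have -> : (M * 1 * (eps^-1 / y)) ^+ 2 * (2 * C ^+ 2) = Hc * (y^-1) ^+ 2.
    by rewrite /Hc; ring.
  apply: ler_wpM2l => //; rewrite expr2.
  by apply: ler_piMr; [rewrite invr_ge0 ltW|rewrite invf_le1].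
by rewrite mul0e add0e; exact: integral_exp_decay.
Qed.

(** On a fixed interval near [r = 1] the weight decays more slowly than [1 / y], while
    [chi >= y / 4] as long as [eps y^2 <= 1]. The integrand is thus bounded below on a time window
    whose length is at will, and [c] does not depend on that length. *)
Lemma sqint_w_ge mu : 0 < mu -> exists2 c : R, 0 < c & forall L, 0 < L ->
  exists2 eps : R, 0 < eps <= 8^-1 &
    ((c * L)%:E <= sqint (weighted phi a1 (wsol mu eps)))%E.
Proof.
move=> mu0; have [r' r'1 phir'] := phi_lam mu0.
pose rho := Num.min x1 (r' - 1).
have rho0 : 0 < rho by rewrite lt_min x10 subr_gt0.
have rho_x1 : rho <= x1 by rewrite ge_min lexx.
have rho_r' : 1 + rho <= r'.
  have : rho <= r' - 1 by rewrite ge_min lexx orbT.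
  by rewrite lerBrDl.
pose c := (m / 4 * (rho / 4)) ^+ 2.
have c0 : 0 < c by rewrite exprn_gt0// mulr_gt0// divr_gt0.
exists (c * (rho / 2)); first by rewrite mulr_gt0// divr_gt0.
(* The window is [[1 / mu, T]]: from [1 / mu] on [y >= 2], and its length exceeds [L]. The choice of
   [eps] gives [eps y^2 = 1] at [t = T], and [mu * T >= 4] gives [eps <= 8^-1]. *)
move=> L L0; pose T := 4 / mu + L.
have muT : 4 <= mu * T by rewrite mulrDr mulrCA mulfV ?gt_eqF// mulr1 lerDl mulr_ge0 ?ltW.
pose eps := expR (- (2 * (mu * T))).
have e0 : 0 < eps by exact: expR_gt0.
exists eps.
  rewrite e0/= /eps expRN lef_pV2 ?posrE ?expR_gt0//.
  apply: le_trans (expR_ge1Dx _).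
  move: (mu * T) muT => z; lra.
have t10 : 0 < 1 / mu by rewrite divr_gt0.
have h2 : (1 + rho / 2) < 1 + rho by rewrite ltrD2l ltr_pdivrMr// ltr_pMr// ltr1n.
have T1 : 1 / mu < T.
  rewrite /T (@lt_le_trans _ _ (4 / mu))//; last by rewrite lerDl ltW.
  by rewrite ltr_pM2r ?invr_gt0// ltr1n.
apply: le_trans (sqint_rect_ge (ltW c0) t10 T1 _ h2 (cmeas_w mu e0) _).
- rewrite lee_fin.
  have -> : 1 + rho - (1 + rho / 2) = rho / 2 by field.
  apply: ler_wpM2l; first by rewrite mulr_ge0 ?ltW// divr_gt0.
  rewrite /T addrAC -mulrBl lerDr.
  by apply: divr_ge0; [rewrite subr_ge0 ler1n|exact: ltW].
- by rewrite ltrDl divr_gt0.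
move=> t r /andP[t1 tT] /andP[r1 r2].
have rho_lt1 : rho < 1 by exact: le_lt_trans x11.
have r1' : 1 < r by apply: lt_le_trans r1; rewrite ltrDl divr_gt0.
have r2' : r < 2 by apply: le_lt_trans r2 _; rewrite -[ltRHS]/(1 + 1 : R) ltrD2l.
have t0 : 0 < t by exact: lt_le_trans t1.
rewrite sqnormc_w//.
have mut : 1 <= mu * t by rewrite mulrC -ler_pdivrMr.
set y := expR (mu * t).
have y2 : 2 <= y by apply: le_trans (expR_ge1Dx _); rewrite -[leLHS]/(1 + 1 : R) lerD2l.
have ey : eps * y ^+ 2 <= 1.
  rewrite /eps /y -expRM_natl -expRD -[leRHS]expR0 ler_expR addrC subr_le0.
  by rewrite ler_pM2l// ler_pM2l.
have ch := chi_ge e0 y2 ey.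
have y0 : 0 < y by exact: expR_gt0.
have ey1 : y^-1 <= expR (t * (phi r - lam)).
  rewrite /y -expRN ler_expR mulrC -mulrN ler_pM2l// lerNl opprB lerBlDl -lerBlDr.
  apply: ltW; apply: phir'; rewrite r1'/=; exact: le_trans rho_r'.
have /andP[m1 _] : m <= a1 r <= M by apply: a1_bnd; rewrite !ltW.
have Plow : rho / 4 <= P.[r].
  apply: (@le_trans _ _ ((r - 1) / 2)); last first.
    by apply: P_low; rewrite r1'/= (le_trans r2)// lerD2l.
  have -> : rho / 4 = (rho / 2) / 2 by field.
  by rewrite ler_pM2r ?invr_gt0// lerBrDl.
have mid : m / 4 <= a1 r * expR (t * (phi r - lam)) * chi eps y.
  have -> : m / 4 = m * y^-1 * (y / 4) by field; rewrite gt_eqF.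
  have yV0 : 0 < y^-1 by rewrite invr_gt0.
  apply: ler_pM => //.
  - by rewrite mulr_ge0 ?ltW.
  - by rewrite divr_ge0 ?ltW.
  - by apply: ler_pM => //; exact: ltW.
rewrite /c exprMn; apply: ler_pM; [exact: sqr_ge0|exact: sqr_ge0| |].
  have m40 : 0 <= m / 4 by rewrite divr_ge0 ?ltW.
  by rewrite ler_sqr// nnegrE (le_trans m40).
apply: (@le_trans _ _ (P.[r] ^+ 2)); last by rewrite lerDl sqr_ge0.
have rho40 : 0 <= rho / 4 by rewrite divr_ge0 ?ltW.
by rewrite ler_sqr// nnegrE (le_trans rho40).
Qed.

(** Just after [t = 0] the factor [chi] is close to [0] but its derivative is not, so [chi' g]
    prevails over [chi (T - lam) g]; the real part alone suffices. *)
Lemma sqint_f_gt0 mu eps : 0 < mu -> 0 < eps <= 8^-1 ->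
  (0 < sqint (weighted phi a2 (fsol mu eps)))%E.
Proof.
move=> mu0 /andP[e0 e8].
(* For [y <= 1 + th] one has [chi <= th], so the residual term is at most [mu / 32 * (r - 1)], half
   of the lower bound [mu / 16 * (r - 1)] for [dchi * P]. The bound [th <= 1] ensures [y <= 2]. *)
pose th := Num.min 1 (mu / (32 * C)).
have th0 : 0 < th by rewrite lt_min ltr01 divr_gt0// mulr_gt0.
have th1 : th <= 1 by rewrite ge_min lexx.
have thC : th * C <= mu / 32.
  have : th <= mu / (32 * C) by rewrite ge_min lexx orbT.
  by rewrite invfM mulrA ler_pdivlMr.
have [z zE] := @expR_total R (1 + th) (addr_gt0 ltr01 th0).
have z0 : 0 < z by rewrite -expR_gt1 zE ltrDl.
pose t2 := z / mu; have t20 : 0 < t2 by rewrite divr_gt0.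
have t12 : t2 / 2 < t2 by rewrite ltr_pdivrMr// ltr_pMr// ltr1n.
have r12 : 1 + x1 / 2 < 1 + x1 by rewrite ltrD2l ltr_pdivrMr// ltr_pMr// ltr1n.
pose e2 := expR (t2 * (phi 2 - lam)).
pose c := (m * e2) ^+ 2 * (x1 / 2 * (mu / 32)) ^+ 2.
have c0 : 0 < c.
  by rewrite mulr_gt0// exprn_gt0// mulr_gt0 ?expR_gt0 ?divr_gt0.
apply: lt_le_trans (sqint_rect_ge (ltW c0) _ t12 _ r12 (cmeas_f mu e0) _).
- by rewrite lte_fin mulr_gt0 ?subr_gt0// mulr_gt0 ?subr_gt0.
- by rewrite divr_gt0.
- by rewrite ltrDl divr_gt0.
move=> t r /andP[t1 tT] /andP[r1 r2].
have r1' : 1 < r by apply: lt_le_trans r1; rewrite ltrDl divr_gt0.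
have r2' : r < 2 by apply: le_lt_trans r2 _; rewrite -[ltRHS]/(1 + 1 : R) ltrD2l.
have t0 : 0 < t by apply: lt_le_trans t1; rewrite divr_gt0.
rewrite sqnormc_f//.
have y1 := expR_ge1t mu0 t0.
set y := expR (mu * t) in y1 *.
have yth : y <= 1 + th.
  by rewrite -zE ler_expR mulrC -ler_pdivlMr.
have d8 : mu / 8 <= dchi mu eps y.
  by apply: dchi_ge => //; rewrite y1/= (le_trans yth)// -[leRHS]/(1 + 1 : R) lerD2l.
have cth : 0 <= chi eps y <= th.
  have /andP[-> _]/= := chi_psi e0 y1.
  have d1 : 1 <= 1 + eps * y ^+ 2 by rewrite lerDl mulr_ge0 ?sqr_ge0// ltW.
  rewrite /chi ler_pdivrMr ?(lt_le_trans ltr01)//.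
  apply: (@le_trans _ _ th); first by rewrite lerBlDl.
  by rewrite ler_peMr// ltW.
have r12' : 1 < r < 2 by rewrite r1'.
have [hA _] := res_bnd r12'.
have x0 : 0 < r - 1 by rewrite subr_gt0.
have xlt1 : r - 1 <= 1 by rewrite lerBlDl ltW.
have Plow : (r - 1) / 2 <= P.[r] by apply: P_low; rewrite r1'.
have xlow : x1 / 2 <= r - 1 by rewrite lerBrDl.
have /andP[m2 _] : m <= a2 r <= M by apply: a2_bnd; rewrite !ltW.
have elow : e2 <= expR (t * (phi r - lam)).
  rewrite ler_expR -[leLHS]mulrNN -[leRHS]mulrNN !opprB !mulNr lerN2.
  apply: ler_pM => //; [exact: ltW|by rewrite subr_ge0 ltW ?phi_lt|].
  by rewrite lerD2l lerN2 ltW// phi_decr// ltW.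
rewrite /c; apply: ler_pM; [exact: sqr_ge0|exact: sqr_ge0| |].
  have me0 : 0 <= m * e2 by rewrite mulr_ge0 ?expR_ge0 ?ltW.
  have me : m * e2 <= a2 r * expR (t * (phi r - lam)).
    by apply: ler_pM => //; [exact: ltW|exact: expR_ge0].
  by rewrite ler_sqr ?nnegrE// (le_trans me0).
set A := opT_re k nu B P S r - lam * P.[r] in hA *.
apply: (@le_trans _ _ ((dchi mu eps y * P.[r] + chi eps y * A) ^+ 2)); last first.
  by rewrite lerDl sqr_ge0.
have low1 : mu / 8 * ((r - 1) / 2) <= dchi mu eps y * P.[r].
  by apply: ler_pM => //; rewrite divr_ge0 ?ltW.
have low2 : `|chi eps y * A| <= mu / 32 * (r - 1).
  have /andP[ch0 cht] := cth; rewrite normrM (ger0_norm ch0).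
  apply: (@le_trans _ _ (th * (C * (r - 1) ^+ 2))).
    by apply: ler_pM.
  rewrite mulrA; apply: ler_pM => //; first by rewrite mulr_ge0 ?ltW.
    exact: sqr_ge0.
  by rewrite expr2 ler_piMr// ltW.
have main : x1 / 2 * (mu / 32) <= dchi mu eps y * P.[r] + chi eps y * A.
  apply: (@le_trans _ _ ((r - 1) * (mu / 32))).
    by rewrite ler_wpM2r// divr_ge0// ltW.
  have := lerD low1 (lerNnormlW low2).
  by apply: le_trans; rewrite le_eqVlt; apply/orP; left; apply/eqP; field.
have pos : 0 <= x1 / 2 * (mu / 32) by rewrite mulr_ge0 ?divr_ge0 ?ltW.
by rewrite ler_sqr ?nnegrE// (le_trans pos).
Qed.

(** Half of [A ^- 2] is spent on the comparison constant [kap]; the other half absorbs [K] once the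
    squared norm of [w] exceeds [K / kap]. Finiteness of the source then follows from that of
    [w]. *)
Lemma amplification A : 0 < A -> exists w f : R -> R -> R[i],
  [/\ strong_solution k nu B w f,
      (sqint (weighted phi a1 w) < +oo)%E,
      (0 < sqint (weighted phi a2 f))%E &
      (sqint (weighted phi a2 f) <= (A ^- 2)%:E * sqint (weighted phi a1 w))%E].
Proof.
move=> A0.
pose kap := (A ^- 2) / 2; have kap0 : 0 < kap by rewrite divr_gt0// invr_gt0 exprn_gt0.
(* This makes [512 C^2 M^2 x0^2 / m^2 <= kap], since [512] is half of [32 ^+ 2]. *)
pose x0 := Num.min x1 (m / (32 * C * M * A)).
have D0 : 0 < 32 * C * M * A by rewrite !mulr_gt0.
have x00 : 0 < x0 by rewrite lt_min x10 divr_gt0.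
have x0x1 : x0 <= x1 by rewrite ge_min lexx.
pose del := lam - phi (1 + x0).
have del0 : 0 < del by rewrite subr_gt0 phi_lt// ltrDl.
pose mu := Num.min x0 (del / 2).
have mu0 : 0 < mu by rewrite lt_min x00 divr_gt0.
have mux0 : mu <= x0 by rewrite ge_min lexx.
have mud : 3 * mu <= 2 * (lam - phi (1 + x0)).
  have : mu <= del / 2 by rewrite ge_min lexx orbT.
  by rewrite -/del; move: (mu) (del) del0 => u v; lra.
have kapE : 512 * C ^+ 2 * M ^+ 2 * x0 ^+ 2 / m ^+ 2 <= kap.
  have h : x0 * (32 * C * M * A) <= m.
    by rewrite -ler_pdivlMr// ge_min lexx orbT.
  have h2 : (x0 * (32 * C * M * A)) ^+ 2 <= m ^+ 2.
    have h0 : 0 <= x0 * (32 * C * M * A) by apply: mulr_ge0; exact: ltW.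
    by rewrite ler_sqr// nnegrE ltW.
  rewrite ler_pdivrMr ?exprn_gt0//.
  have -> : 512 * C ^+ 2 * M ^+ 2 * x0 ^+ 2 = kap * (x0 * (32 * C * M * A)) ^+ 2.
    by rewrite /kap; field; rewrite gt_eqF.
  by rewrite ler_wpM2l// ltW.
pose H (t : R) := 256 * M ^+ 2 * C ^+ 2 * expR (- mu * t).
have Hc0 : 0 <= 256 * M ^+ 2 * C ^+ 2 by rewrite !(sqr_ge0, mulr_ge0).
have mH : measurable_fun Time H.
  apply: (measurable_funS measurableT) => //; apply: continuous_measurable_fun => t.
  by apply: cvgMr; exact: continuous_expRM.
have H0 t : Time t -> 0 <= H t by move=> _; rewrite mulr_ge0 ?expR_ge0.
have IH0 : (0 <= \int[leb]_(t in Time) (H t)%:E)%E.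
  by apply: integral_ge0 => t Tt; rewrite lee_fin H0.
have IHoo : (\int[leb]_(t in Time) (H t)%:E < +oo)%E by exact: integral_exp_decay.
have [K KE] : exists K, (\int[leb]_(t in Time) (H t)%:E = K%:E)%E.
  by exists (fine (\int[leb]_(t in Time) (H t)%:E)%E); rewrite fineK// ge0_fin_numE.
have K0 : 0 <= K by rewrite -lee_fin -KE.
have [c c0 Hc] := sqint_w_ge mu0.
(* With this [L], [kap * (c * L) = K + 1]; the summand [1] keeps [L] positive when [K = 0]. *)
have L0 : 0 < (K + 1) / (kap * c).
  by apply: divr_gt0; [exact: ltr_wpDl|exact: mulr_gt0].
have [eps e08 low] := Hc _ L0.
have /andP[e0 _] := e08.
exists (wsol mu eps), (fsol mu eps); split.
- exact: strong_solution_sol.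
- exact: sqint_w_lty.
- exact: sqint_f_gt0.
have dom : (sqint (weighted phi a2 (fsol mu eps)) <=
    kap%:E * sqint (weighted phi a1 (wsol mu eps)) + K%:E)%E.
  rewrite -KE; apply: sqint_le => //; first exact: measurable_Time.
  - exact: cmeas_w.
  - exact: cmeas_f.
  - exact: ltW.
  move=> t r Tt rO.
  have x0b : 0 < x0 <= x1 by rewrite x00.
  apply: le_trans (pointwise_domination mu0 e0 x0b mux0 mud Tt rO) _.
  by rewrite lerD2r ler_wpM2r// sqnormc_ge0.
apply: (le_trans dom).
have -> : (A ^- 2)%:E = (kap%:E + kap%:E)%E :> \bar R.
  by rewrite -EFinD /kap -splitr.
rewrite ge0_muleDl; [|by rewrite lee_fin ltW..].
rewrite leeD2l//.
have : (kap%:E * (c * ((K + 1) / (kap * c)))%:E <=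
  kap%:E * sqint (weighted phi a1 (wsol mu eps)))%E.
  apply: lee_pmul => //; rewrite lee_fin; first exact: ltW.
  by apply: mulr_ge0; exact: ltW.
apply: le_trans; rewrite -EFinM lee_fin.
have -> : kap * (c * ((K + 1) / (kap * c))) = K + 1.
  by field; rewrite !gt_eqF.
by rewrite lerDl.
Qed.

End concentration.

(** * From squared integrals to the ratio of norms *)

Section ratio.
Context {R : realType}.

Lemma weighted_normE phi a (W : R -> R -> R[i]) :
  weighted_norm phi a W = sqrte (sqint (weighted phi a W)).
Proof. exact: L2t_normE. Qed.

Lemma sqint_ge0 (W : R -> R -> R[i]) : (0 <= sqint W)%E.
Proof.
apply: integral_ge0 => t _; apply: integral_ge0 => r _.
by rewrite lee_fin sqnormc_ge0.
Qed.

Lemma sqrte_ratio_ge (A : R) (p q : \bar R) : 0 < A -> (0 <= p < +oo)%E ->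
  (0 < q)%E -> (q <= (A ^- 2)%:E * p)%E ->
  [/\ (sqrte p + sqrte q < +oo)%E, (0 < sqrte q)%E &
      (A%:E <= sqrte p / sqrte q)%E].
Proof.
move=> A0 /andP[]; case: p => [p| |]//; rewrite lee_fin => p0 _.
case: q => [q| |]//; rewrite lte_fin -EFinM lee_fin => q0 qp.
have sq0 : 0 < Num.sqrt q by rewrite sqrtr_gt0.
split; rewrite /=; first by rewrite -EFinD ltry.
  by rewrite lte_fin.
rewrite inver gt_eqF// lee_pdivlMr// -EFinM lee_fin.
rewrite -(ger0_norm (ltW A0)) -sqrtr_sqr -sqrtrM ?sqr_ge0// ler_wsqrtr//.
by move: qp; rewrite mulrC ler_pdivlMr ?exprn_gt0// mulrC.
Qed.

End ratio.

Unset Implicit Arguments.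

Theorem theorem1p2 (R : realType) (k : int) (nu B : R) (hnu : 0 < nu)
  (a1 a2 phi : R -> R)
  (a1_cont : {within `[1, +oo[, continuous a1})
  (a2_cont : {within `[1, +oo[, continuous a2})
  (a1_gt0 : forall r, 1 <= r -> 0 < a1 r)
  (a2_gt0 : forall r, 1 <= r -> 0 < a2 r)
  (phi_decr : forall r s, 1 <= r -> r < s -> phi s < phi r) :
  exists w f : nat -> R -> R -> R[i],
    (forall n, [/\ strong_solution k nu B (w n) (f n),
       (weighted_norm phi a1 (w n) + weighted_norm phi a2 (f n) < +oo)%E &
       (0 < weighted_norm phi a2 (f n))%E]) /\
    limn_esup (fun n =>
      (weighted_norm phi a1 (w n) / weighted_norm phi a2 (f n))%E) = +oo%E.
Proof.
have [lam [phi_lt phi_lam]] := sup_decreasing phi_decr.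
have [m1 [M1 [m10 b1]]] := weight_bounds a1_cont a1_gt0.
have [m2 [M2 [m20 b2]]] := weight_bounds a2_cont a2_gt0.
pose m := Num.min m1 m2; pose M := Num.max M1 M2.
have m0 : 0 < m by rewrite lt_min m10.
have bm1 r : 1 <= r <= 2 -> m <= a1 r <= M.
  by move=> /b1/andP[h h']; rewrite ge_min le_max h h'.
have bm2 r : 1 <= r <= 2 -> m <= a2 r <= M.
  by move=> /b2/andP[h h']; rewrite ge_min le_max h h' !orbT.
have M0 : 0 < M.
  have /andP[h h'] : m <= a1 1 <= M by apply: bm1; rewrite lexx ler1n.
  exact: lt_le_trans m0 (le_trans h h').
have [P [S [C [x1 [aP aS C0 /andP[x10 x11] [PSb resb Pl]]]]]] :=
  @space_profile R k nu B lam hnu.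
have amp (n : nat) : exists wf : (R -> R -> R[i]) * (R -> R -> R[i]),
    strong_solution k nu B wf.1 wf.2 /\
    [/\ (weighted_norm phi a1 wf.1 + weighted_norm phi a2 wf.2 < +oo)%E,
        (0 < weighted_norm phi a2 wf.2)%E &
        ((n.+1%:R)%:E <= weighted_norm phi a1 wf.1 / weighted_norm phi a2 wf.2)%E].
  have n0 : 0 < n.+1%:R :> R by rewrite ltr0n.
  have [w [f [ss woo f0 fw]]] := @amplification R k nu B a1 a2 phi lam m M C x1 P S
    (measurable_weight a1_cont) (measurable_weight a2_cont)
    (measurable_decreasing phi_decr) phi_decr phi_lt phi_lam m0 M0 bm1 bm2
    aP aS C0 x10 x11 PSb resb Pl n.+1%:R n0.
  exists (w, f); split=> //=; rewrite !weighted_normE.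
  by apply: sqrte_ratio_ge => //; rewrite sqint_ge0.
have [wf wfP] := choice amp.
exists (fun n => (wf n).1), (fun n => (wf n).2); split.
  by move=> n; have [ss [h1 h2 _]] := wfP n.
have cvgy : (weighted_norm phi a1 (wf n).1 / weighted_norm phi a2 (wf n).2)%E
    @[n --> \oo] --> +oo%E.
  apply/cvgeyPge => A; near=> n; have [_ [_ _ h]] := wfP n.
  apply: le_trans h; rewrite lee_fin.
  apply: (@le_trans _ _ n%:R); last by rewrite ler_nat.
  by near: n; exact: nbhs_infty_ger.
rewrite is_cvg_limn_esupE; last by apply/cvg_ex; exists +oo%E.
exact: cvg_lim.
Unshelve. all: by end_near. Qed.
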